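(* Let $q=2$, $F=\mathbb F_2(T)$, $A=\mathbb F_2[T]$, and let $\mathfrak p\triangleleft A$ be a prime ideal with $\deg(\mathfrak p)\geq3$. Let $\phi:A\to F\{\tau\}$ be a Drinfeld module of rank two which has good reduction at every place of $F$ different from $\infty$. Then $\phi$ does not have a $\mathrm{Gal}(\overline F|F)$-invariant cyclic $\mathfrak p$-torsion subgroup.
   Context: $\infty$ is the place of $F$ at infinity (corresponding to $1/T$). A Drinfeld module of rank two over $F$ is an $\mathbb F_2$-algebra homomorphism $\phi:A\to F\{\tau\}$ with $\phi(T)=T+g\tau+\Delta\tau^2$, $\Delta\neq0$; it has good reduction at a place $v$ if it is isomorphic over $F$ to one with $\phi(T)$ having coefficients $g$, $\Delta$ in the valuation ring $\mathcal O_v$ and $\Delta\in\mathcal O_v^*$. A cyclic $\mathfrak p$-torsion subgroup is an $A$-submodule of $\phi[\mathfrak p](\overline F)$ isomorphic to $A/\mathfrak p$ (a one-dimensional $A/\mathfrak p$-subspace), $\overline F$ being a separable closure of $F$. *)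

(* Defs.v *)
From HB Require Import structures.
From mathcomp Require Import all_boot all_order all_algebra all_field.
From mathcomp Require Import fraction.
Set Implicit Arguments. Unset Strict Implicit. Unset Printing Implicit Defensive.
Import GRing.Theory.
Local Open Scope ring_scope.

Notation "x %:F" := (@FracField.tofrac _ x).

Definition A := {poly 'F_2}.
Definition F := {fraction A}.
Definition Tvar : F := ('X : A)%:F.
Definition constF (c : 'F_2) : F := (c%:P : A)%:F.

(* Valuation ring O_P and its units, for a finite place P (monic irreducible). *)
Definition in_O (P : A) (f : F) : Prop :=
  exists a b : A, ~~ (P %| b) /\ f = a%:F / b%:F.
Definition in_Ounit (P : A) (f : F) : Prop :=
  exists a b : A, ~~ (P %| a) /\ ~~ (P %| b) /\ f = a%:F / b%:F.

(* phi_T = T + g tau + D tau^2 is isomorphic over F to psi_T = T + g' tau + D' tau^2: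
   there is u in F^x with u * phi_T = psi_T * u in F{tau} (q = 2), i.e. coefficientwise
   u*T = T*u, u*g = g'*u^2, u*D = D'*u^4. *)
Definition drinfeld_iso (g D g' D' : F) : Prop :=
  exists u : F, u != 0 /\ u * Tvar = Tvar * u /\ u * g = g' * u ^+ 2 /\ u * D = D' * u ^+ 4.

Definition good_reduction_at (P : A) (g D : F) : Prop :=
  exists g' D' : F, drinfeld_iso g D g' D' /\ in_O P g' /\ in_O P D' /\ in_Ounit P D'.

Definition is_sep_closure (L : fieldType) (iota : {rmorphism F -> L}) : Prop :=
  (forall x : L, exists p : {poly F},
       p != 0 /\ separable_poly p /\ root (map_poly iota p) x) /\
  (forall p : {poly L}, (1 < size p)%N -> separable_poly p -> exists x, root p x).

(* Action of phi_T and phi_a (a in A) on L (tau = Frobenius x |-> x^2). *)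
Definition phiT (L : fieldType) (iota : {rmorphism F -> L}) (g D : F) (x : L) : L :=
  iota Tvar * x + iota g * x ^+ 2 + iota D * x ^+ 4.
Definition phi_act (L : fieldType) (iota : {rmorphism F -> L}) (g D : F) (a : A) (x : L) : L :=
  \sum_(i < size a) iota (constF a`_i) * iter i (phiT iota g D) x.

(* C is a cyclic p-torsion subgroup (p = (pi)): an A-submodule of phi[p](L) isomorphic
   to A/p, i.e. C = {phi_a x | a in A} for some x whose annihilator is exactly p. *)
Definition cyclic_ptors (L : fieldType) (iota : {rmorphism F -> L}) (g D : F) (pi : A)
    (C : L -> Prop) : Prop :=
  (forall c, C c -> phi_act iota g D pi c = 0) /\
  exists x : L, (forall y, C y <-> exists a : A, y = phi_act iota g D a x) /\
                (forall a : A, phi_act iota g D a x = 0 <-> pi %| a).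

Definition gal_aut (L : fieldType) (iota : {rmorphism F -> L}) (s : {rmorphism L -> L}) : Prop :=
  bijective s /\ forall f : F, s (iota f) = iota f.

Definition gal_invariant (L : fieldType) (iota : {rmorphism F -> L}) (C : L -> Prop) : Prop :=
  forall s : {rmorphism L -> L}, gal_aut iota s ->
    forall y, C y <-> exists x, C x /\ s x = y.

(* Main.v *)
Require Import Defs.
From HB Require Import structures.
From mathcomp Require Import all_boot all_order all_algebra all_field.
From mathcomp Require Import fraction zify ring.
From mathcomp Require Import boolp classical_sets.
Set Implicit Arguments. Unset Strict Implicit. Unset Printing Implicit Defensive.
Import Order.TTheory GRing.Theory Num.Theory.
Local Open Scope ring_scope.

(* Good reduction at all finite places lets one scale the module to [T + G tau + tau^2]
   with [G] in [A]. The subgroup of order 2^d, d = deg p, is then the kernel of a monic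
   [u] in [A{tau}], its coefficients being Galois invariant and integral, and right
   division gives [u phi_T = phi'_T u] and [v u = phi_p], with [phi'] of the same shape.
   The constant coefficients satisfy [v_0 u_0 = p]; replacing [u] by the dual isogeny
   [v] if needed, [u_0 = 1].

   Everything else happens at the place infinity. Composition of Gauss norms forces
   [deg G' > deg G], so the smallest break of the Newton polygon of [u] is a simple one:
   [u] has a root of minimal degree in the completion [F_2((1/T))], and as [p] is prime
   that root generates the whole kernel. With [M = max 1 (deg G)], the degrees of its
   iterates under [phi_T] cannot exceed [1 - M], since they would then run through the
   values [2^k - M] and diverge, [3 M] not being a power of 2. Hence all roots of [u]
   have degree at most 0, so [u] has constant coefficients, which the commutation
   relation excludes for [d > 1]. The completion is avoided by working with
   sufficiently good approximations in [F]. *)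

(** * Skew polynomials in characteristic 2 *)

(** Units are trivial throughout. An isomorphism changes the top coefficient by a cube, so good
    reduction makes its valuations at the finite places divisible by 3; as [A] is principal with
    unit group {1}, it is a cube. For the same reason v_0 u_0 = p leaves only the pairs (1, p) and
    (p, 1). At infinity the residue field is F_2, so two elements of equal degree have a sum of
    smaller degree.

    Approximating the root by some y in [F] has a price: the multiples of y by a in [A] are no
    longer exact roots, and nothing prevents them a priori from being negligible. Two precisions
    deal with this. A Bezout relation e a + f p = 1 recovers y from its multiple by a, up to an
    error controlled by v u = phi_p; hence this multiple stays above degree -K for every nonzero a
    of degree below d. The approximation is then taken so fine that the values of u at all these
    multiples lie below -K. The 2^d multiples can now be counted by degree, like exact roots,
    against the slopes of the Newton polygon. *)

Section SkewPolynomials.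
Variables (R : comNzRingType) (char2 : 2%N \in [pchar R]).
Implicit Types (f g u : {poly R}) (x y : R).

Lemma addxx x : x + x = 0.
Proof. by rewrite -mulr2n -mulr_natr pcharf0 ?mulr0. Qed.

Lemma frobD x y i : (x + y) ^+ (2 ^ i) = x ^+ (2 ^ i) + y ^+ (2 ^ i).
Proof.
elim: i => [//|i IH]; rewrite expnS mulnC !exprM IH sqrrD.
by rewrite -mulr_natr pcharf0 ?mulr0 // addr0.
Qed.

Lemma frob_sum I (r : seq I) (P : pred I) (G : I -> R) i :
  (\sum_(j <- r | P j) G j) ^+ (2 ^ i) = \sum_(j <- r | P j) G j ^+ (2 ^ i).
Proof.
apply: (big_morph (fun z => z ^+ (2 ^ i))) => [x y|]; first exact: frobD.
by rewrite expr0n expn_eq0.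
Qed.

Lemma expr0_pow2 i : (0 : R) ^+ (2 ^ i) = 0.
Proof. by rewrite expr0n expn_eq0. Qed.

(* A polynomial is used as the list of coefficients of a skew polynomial:
   [f] stands for the sum of the [f`_i tau^i], and [skew_eval f] is the
   additive map it defines. *)
Definition skew_eval f x := \sum_(i < size f) f`_i * x ^+ (2 ^ i).

(** Multiplication with the rule [tau c = c^2 tau]: moving tau^i past [g] raises the coefficients of
    [g] to the power 2^i. *)
Definition skew_mul f g :=
  \sum_(i < size f) f`_i *: (map_poly (fun c => c ^+ (2 ^ i)) g * 'X^i).

Lemma skew_evalE n f x : (size f <= n)%N ->
  skew_eval f x = \sum_(i < n) f`_i * x ^+ (2 ^ i).
Proof.
move=> le_fn; rewrite /skew_eval (big_ord_widen n (fun i => f`_i * x ^+ (2 ^ i)) le_fn).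
rewrite [RHS](bigID (fun i : 'I_n => (i < size f)%N)) /= [X in _ + X]big1 ?addr0 //.
by move=> i; rewrite -leqNgt => /(nth_default 0) ->; rewrite mul0r.
Qed.

Lemma skew_evalD f g x : skew_eval (f + g) x = skew_eval f x + skew_eval g x.
Proof.
pose n := maxn (size f) (size g).
rewrite !(@skew_evalE n) ?leq_maxl ?leq_maxr //; last exact: size_polyD.
by rewrite -big_split; apply: eq_bigr => i _; rewrite coefD mulrDl.
Qed.

Lemma skew_evalZ c f x : skew_eval (c *: f) x = c * skew_eval f x.
Proof.
rewrite (@skew_evalE (size f)) ?size_scale_leq // mulr_sumr.
by apply: eq_bigr => i _; rewrite coefZ mulrA.
Qed.

Lemma skew_eval_poly0 x : skew_eval 0 x = 0.
Proof. by rewrite /skew_eval size_poly0 big_ord0. Qed.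

Lemma skew_eval_sum I (r : seq I) (P : pred I) (G : I -> {poly R}) x :
  skew_eval (\sum_(j <- r | P j) G j) x = \sum_(j <- r | P j) skew_eval (G j) x.
Proof.
apply: (big_morph (fun f => skew_eval f x)) => [f g|]; first exact: skew_evalD.
exact: skew_eval_poly0.
Qed.

Lemma skew_evalC c x : skew_eval c%:P x = c * x.
Proof. by rewrite (@skew_evalE 1) ?size_polyC_leq1 // big_ord1 coefC. Qed.

Lemma skew_evalXn i x : skew_eval 'X^i x = x ^+ (2 ^ i).
Proof.
rewrite /skew_eval size_polyXn big_ord_recr /= big1 ?add0r => [|j _].
  by rewrite coefXn eqxx mul1r.
by rewrite coefXn ltn_eqF ?mul0r.
Qed.

Lemma skew_evalX x : skew_eval 'X x = x ^+ 2.
Proof. exact: (skew_evalXn 1). Qed.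

Lemma skew_eval0 f : skew_eval f 0 = 0.
Proof. by apply: big1 => i _; rewrite expr0_pow2 mulr0. Qed.

Lemma skew_eval_add f x y : skew_eval f (x + y) = skew_eval f x + skew_eval f y.
Proof. by rewrite -big_split; apply: eq_bigr => i _; rewrite frobD mulrDr. Qed.

Lemma skew_eval_bigsum I (r : seq I) (P : pred I) (G : I -> R) f :
  skew_eval f (\sum_(j <- r | P j) G j) = \sum_(j <- r | P j) skew_eval f (G j).
Proof.
apply: (big_morph (skew_eval f)) => [x y|]; first exact: skew_eval_add.
exact: skew_eval0.
Qed.

Lemma skew_eval_mul f g x : skew_eval (skew_mul f g) x = skew_eval f (skew_eval g x).
Proof.
rewrite skew_eval_sum; apply: eq_bigr => i _; rewrite skew_evalZ; congr (_ * _).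
rewrite frob_sum (@skew_evalE (i + size g)); last first.
  apply: leq_trans (size_polyMleq _ _) _; rewrite size_polyXn addnS addnC /= leq_add2l.
  exact: size_poly.
rewrite big_split_ord /= big1 ?add0r => [|j _]; last first.
  by rewrite coefMXn ltn_ord mul0r.
apply: eq_bigr => j _; rewrite coefMXn ltnNge leq_addr /= addKn.
by rewrite coef_map_id0 ?expr0_pow2 // exprMn -exprM -expnD addnC.
Qed.

Lemma coef_skew_mul_widen n f g k : (size f <= n)%N ->
  (skew_mul f g)`_k =
    \sum_(i < n) f`_i * (if (k < i)%N then 0 else g`_(k - i) ^+ (2 ^ i)).
Proof.
move=> le_fn.
rewrite [RHS](bigID (fun i : 'I_n => (i < size f)%N)) /= [X in _ + X]big1 ?addr0.
  rewrite -(big_ord_widen n (fun i : nat => f`_i * (if (k < i)%N then 0 else g`_(k - i) ^+ (2 ^ i))) le_fn).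
  rewrite coef_sum; apply: eq_bigr => i _; rewrite coefZ coefMXn; case: ifP => // _.
  by rewrite coef_map_id0 ?expr0_pow2.
by move=> i; rewrite -leqNgt => /(nth_default 0) ->; rewrite mul0r.
Qed.

Lemma coef_skew_mul f g k :
  (skew_mul f g)`_k = \sum_(i < k.+1) f`_i * g`_(k - i) ^+ (2 ^ i).
Proof.
have le1 : (size f <= maxn (size f) k.+1)%N by apply: leq_maxl.
have le2 : (k.+1 <= maxn (size f) k.+1)%N by apply: leq_maxr.
rewrite (coef_skew_mul_widen g k le1).
rewrite (big_ord_widen _ (fun i => f`_i * g`_(k - i) ^+ (2 ^ i)) le2) [RHS]big_mkcond /=.
by apply: eq_bigr => i _; rewrite ltnS [(i <= k)%N]leqNgt; case: (k < i)%N; rewrite ?mulr0.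
Qed.

Lemma skew_mulDl f g u : skew_mul (f + g) u = skew_mul f u + skew_mul g u.
Proof.
apply/polyP => k; rewrite coefD !coef_skew_mul -big_split; apply: eq_bigr => i _.
by rewrite coefD mulrDl.
Qed.

Lemma skew_mul_coef_top a b f g : (size f <= a.+1)%N -> (size g <= b.+1)%N ->
  (skew_mul f g)`_(a + b) = f`_a * g`_b ^+ (2 ^ a).
Proof.
move=> sf sg; rewrite coef_skew_mul (bigD1 (inord a)) //= inordK ?ltnS ?leq_addr //.
rewrite addKn big1 ?addr0 // => i ne_ia.
have {}ne_ia : (i : nat) != a.
  by apply: contra_neq ne_ia => eq_ia; apply: val_inj; rewrite /= inordK ?ltnS ?leq_addr.
case: (ltngtP i a) ne_ia => // [lt_ia|lt_ai] _.
  by rewrite [g`__]nth_default ?expr0_pow2 ?mulr0 //; apply: leq_trans sg _; clear char2; lia.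
by rewrite nth_default ?mul0r //; apply: leq_trans sf _.
Qed.

Lemma size_skew_mul_leq a b f g : (size f <= a.+1)%N -> (size g <= b.+1)%N ->
  (size (skew_mul f g) <= (a + b).+1)%N.
Proof.
move=> sf sg; apply/leq_sizeP => k lt_k; rewrite coef_skew_mul big1 // => i _.
case: (leqP i a) => [le_ia|lt_ai].
  by rewrite [g`__]nth_default ?expr0_pow2 ?mulr0 //; apply: leq_trans sg _; clear char2; lia.
by rewrite nth_default ?mul0r //; apply: leq_trans sf _.
Qed.

Definition skew_monic n f := (size f == n.+1) && (f`_n == 1).

Lemma skew_monic_size n f : skew_monic n f -> size f = n.+1.
Proof. by case/andP=> /eqP. Qed.

Lemma skew_monic_lead n f : skew_monic n f -> f`_n = 1.
Proof. by case/andP=> _ /eqP. Qed.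

Lemma skew_monicI n f : (size f <= n.+1)%N -> f`_n = 1 -> skew_monic n f.
Proof.
move=> sf fn; rewrite /skew_monic fn eqxx andbT eqn_leq sf ltnNge.
by apply: contra_eqN fn => /(nth_default 0) ->; rewrite eq_sym oner_neq0.
Qed.

Lemma skew_monic_mul a b f g :
  skew_monic a f -> skew_monic b g -> skew_monic (a + b) (skew_mul f g).
Proof.
case/andP=> /eqP sf /eqP lf /andP[/eqP sg /eqP lg].
apply: skew_monicI; first by rewrite size_skew_mul_leq ?sf ?sg.
by rewrite skew_mul_coef_top ?sf ?sg // lf lg expr1n mulr1.
Qed.

Lemma skew_mul_cancel f u n : skew_monic n u -> skew_mul f u = 0 -> f = 0.
Proof.
case/andP=> /eqP su /eqP lu fu0; apply/eqP; apply: contra_eqT fu0 => f_neq0.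
have sf : size f = (size f).-1.+1 by rewrite prednK // size_poly_gt0.
have: (skew_mul f u)`_((size f).-1 + n) != 0.
  by rewrite skew_mul_coef_top -?sf ?su // lu expr1n mulr1 -lead_coefE lead_coef_eq0.
by apply: contra_neq => ->; rewrite coef0.
Qed.

Lemma skew_div n u f : skew_monic n u ->
  exists q r, f = skew_mul q u + r /\ (size r <= n)%N.
Proof.
move=> mu; case/andP: (mu) => /eqP su /eqP lu.
elim: {f}(size f) {-2}f (leqnn (size f)) => [|k IH] f sf.
  exists 0, f; split; last by apply: leq_trans sf _.
  by rewrite /skew_mul size_poly0 big_ord0 add0r.
case: (leqP (size f) n) => [le_fn|lt_nf].
  by exists 0, f; rewrite /skew_mul size_poly0 big_ord0 add0r.
have le_nk : (n <= k)%N by rewrite -ltnS (leq_trans lt_nf).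
pose q1 := f`_k *: 'X^(k - n) : {poly R}.
have sq1 : (size q1 <= (k - n).+1)%N.
  by apply: leq_trans (size_scale_leq _ _) _; rewrite size_polyXn.
have [|q [r [def_f sr]]] := IH (f - skew_mul q1 u).
  apply/leq_sizeP => j; rewrite leq_eqVlt => /predU1P[<-|lt_kj].
    rewrite coefB -{2}(subnK le_nk) skew_mul_coef_top ?su // lu expr1n mulr1.
    by rewrite coefZ coefXn eqxx mulr1 subrr.
  rewrite coefB nth_default ?(leq_trans sf) // nth_default ?subr0 //.
  by apply: leq_trans (size_skew_mul_leq sq1 (eq_leq su)) _; rewrite subnK.
exists (q + q1), r; split=> //.
by rewrite skew_mulDl addrAC -def_f subrK.
Qed.

End SkewPolynomials.

Section SkewMorphism.
Variables (R S : comNzRingType) (char2R : 2%N \in [pchar R]) (char2S : 2%N \in [pchar S]).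
Variable rho : {rmorphism R -> S}.

Lemma skew_eval_map f x : skew_eval (map_poly rho f) (rho x) = rho (skew_eval f x).
Proof.
rewrite (@skew_evalE _ (size f)) ?size_poly // [in RHS]/skew_eval rmorph_sum /=; apply: eq_bigr => i _.
by rewrite coef_map rmorphM rmorphXn.
Qed.

Lemma map_skew_mul f g :
  map_poly rho (skew_mul f g) = skew_mul (map_poly rho f) (map_poly rho g).
Proof.
apply/polyP => k; rewrite coef_map /= !coef_skew_mul // rmorph_sum.
by apply: eq_bigr => i _; rewrite rmorphM rmorphXn !coef_map.
Qed.

Lemma skew_monic_map n f : skew_monic n f -> skew_monic n (map_poly rho f).
Proof.
case/andP=> /eqP sf /eqP lf; apply: skew_monicI; first by rewrite -sf size_poly.
by rewrite coef_map /= lf rmorph1.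
Qed.
End SkewMorphism.

(** For n > 0, [f] read as an ordinary polynomial has degree at most 2^(n-1), too small for 2^n
    zeros; its coefficients are recovered because the exponents 2^i are distinct. *)
Lemma skew_eval_zeros (K : idomainType) (f : {poly K}) (s : seq K) n :
    (size f <= n)%N -> uniq s -> (2 ^ n <= size s)%N ->
    (forall x, x \in s -> skew_eval f x = 0) -> f = 0.
Proof.
case: n => [|n] sf us les zs; first by apply/eqP; rewrite -size_poly_leq0.
pose P : {poly K} := \sum_(i < n.+1) f`_i *: 'X^(2 ^ i).
have sP : (size P <= 2 ^ n.+1)%N.
  apply: leq_trans (size_sum _ _ _) _; apply/bigmax_leqP => i _.
  apply: leq_trans (size_scale_leq _ _) _; rewrite size_polyXn.
  rewrite expnS mul2n -addnn; apply: (@leq_trans (2 ^ n).+1).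
    by rewrite ltnS leq_exp2l // -ltnS.
  by rewrite -addn1 leq_add2l expn_gt0.
have P0 : P = 0.
  apply/eqP; apply: contraT => P_neq0.
  have := max_poly_roots P_neq0 _ us; rewrite ltnNge (leq_trans sP les).
  apply; apply/allP => x /zs fx0; apply/rootP; rewrite -fx0 (skew_evalE _ sf).
  by rewrite horner_sum; apply: eq_bigr => i _; rewrite hornerZ hornerXn.
apply/polyP => i; rewrite coef0; case: (ltnP i n.+1) => [lt_in|le_ni]; last first.
  by rewrite nth_default ?(leq_trans sf).
have: P`_(2 ^ i) = 0 by rewrite P0 coef0.
rewrite coef_sum (bigD1 (Ordinal lt_in)) //= big1 ?addr0 => [|j ne_ji].
  by rewrite coefZ coefXn eqxx mulr1.
rewrite coefZ coefXn eqn_exp2l //; case: eqP => [eq_ij|]; last by rewrite mulr0.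
by case/eqP: ne_ji; apply: val_inj.
Qed.

(** * The degree at infinity *)

Lemma frac_repr (R : idomainType) (x : {fraction R}) :
  x = (\n_(repr x))%:F / (\d_(repr x))%:F.
Proof.
have d0 := denom_ratioP (repr x).
apply: (mulIf (x := (\d_(repr x))%:F)); first by rewrite tofrac_eq0.
rewrite mulfVK ?tofrac_eq0 //; rewrite -{1}[x]reprK; unlock FracField.tofrac.
rewrite -[LHS]FracField.pi_mul /FracField.mulf !numden_Ratio ?oner_neq0 //.
apply/eqmodP; rewrite /= FracField.equivfE !numden_Ratio ?mulr1 ?oner_neq0 //.
by rewrite mulrC.
Qed.

Lemma tofrac_inj : injective (@FracField.tofrac {poly 'F_2}).
Proof. by move=> a b /eqP; rewrite tofrac_eq => /eqP. Qed.

Lemma pcharA : 2%N \in [pchar {poly 'F_2}].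
Proof. by rewrite (rmorph_pchar (@polyC 'F_2)) // pchar_Fp. Qed.

Lemma pcharF : 2%N \in [pchar F].
Proof. by apply: (rmorph_pchar (@FracField.tofrac {poly 'F_2})); apply: pcharA. Qed.

Lemma F2_cases (c : 'F_2) : c = 0 \/ c = 1.
Proof. by case: c => [[|[|]]] //= i; [left|right]; apply: val_inj. Qed.

Lemma F2_neq0 (c : 'F_2) : c != 0 -> c = 1.
Proof. by case: (F2_cases c) => ->; rewrite ?eqxx. Qed.

Lemma size1_F2 (q : {poly 'F_2}) : size q = 1%N -> q = 1.
Proof. by move=> /eqP/size_poly1P[c c0 ->]; rewrite (F2_neq0 c0) polyC1. Qed.

(** * Divisibility by an irreducible polynomial *)

Section Irreducible.
Variables (P : {poly 'F_2}) (P_irr : irreducible_poly P).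

Lemma irreducible_coprime a : ~~ (P %| a) -> coprimep P a.
Proof.
move=> nd; have [_ irr] := P_irr; rewrite /coprimep; apply: contraT => ng1.
by case/negP: nd; rewrite -(eqp_dvdl _ (irr _ ng1 (dvdp_gcdl P a))) dvdp_gcdr.
Qed.

Lemma irreducible_dvd_mul a b : P %| a * b -> (P %| a) || (P %| b).
Proof.
have [//|/irreducible_coprime cop] := boolP (P %| a).
by rewrite Gauss_dvdpr.
Qed.

Lemma irreducible_dvd_exp a n : P %| a ^+ n -> P %| a.
Proof.
elim: n => [|n IH]; first by rewrite expr0 dvdp1; case: P_irr => + _ => /gtn_eqF ->.
by rewrite exprS => /irreducible_dvd_mul /orP[|/IH].
Qed.

Lemma irreducible_coprime_dvd a b : coprimep a b -> P %| a -> P %| b -> False.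
Proof.
move=> cop Pa Pb; have := dvdp_gcd P a b; rewrite Pa Pb => dvd.
have := cop; rewrite -gcdp_eqp1 => /eqp_dvdr E; move: dvd; rewrite E dvdp1.
by case: P_irr => + _ => /gtn_eqF ->.
Qed.
End Irreducible.

Definition psize (a : A) : nat := size a.
Definition fnum (x : F) : A := \n_(repr x).
Definition fden (x : F) : A := \d_(repr x).

Lemma psize_mul (a b : A) : a != 0 -> b != 0 ->
  psize (a * b) = (psize a + psize b).-1.
Proof. exact: size_mul. Qed.

Lemma psize_gt0 (a : A) : a != 0 -> (0 < psize a)%N.
Proof. by move=> a0; rewrite size_poly_gt0. Qed.

Lemma psize1 : psize 1 = 1%N.
Proof. exact: size_poly1. Qed.

Lemma psize_add (a b : A) : (psize (a + b)%R <= maxn (psize a) (psize b))%N.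
Proof. exact: size_polyD. Qed.

Lemma fden_neq0 x : fden x != 0.
Proof. exact: denom_ratioP. Qed.

Lemma fnum_fden x : x = (fnum x)%:F / (fden x)%:F.
Proof. exact: frac_repr. Qed.

(* [deg_le x n] says that [x] has degree at most [n] at the place infinity;
   it holds for every [n] when [x = 0]. *)
Definition deg_le (x : F) (n : int) :=
  (x == 0) || ((psize (fnum x))%:Z <= (psize (fden x))%:Z + n).

Definition deg_eq (x : F) (n : int) := deg_le x n && ~~ deg_le x (n - 1).

Lemma deg_le_frac (a b : A) n : a != 0 -> b != 0 ->
  deg_le (a%:F / b%:F) n = ((psize a)%:Z <= (psize b)%:Z + n).
Proof.
move=> a0 b0; set x : F := _ / _.
have x0 : x != 0 by rewrite mulf_neq0 ?invr_neq0 ?tofrac_eq0.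
rewrite /deg_le (negPf x0) /=.
have d0 := fden_neq0 x.
have n0 : fnum x != 0.
  by apply: contra_neq x0 => n0; rewrite [x]fnum_fden n0 tofrac0 mul0r.
have: x = (fnum x)%:F / (fden x)%:F by apply: fnum_fden.
rewrite {1}/x => /eqP; rewrite eqr_div ?tofrac_eq0 // -!tofracM tofrac_eq => /eqP.
move/(congr1 psize); rewrite !psize_mul //.
have := psize_gt0 a0; have := psize_gt0 b0; have := psize_gt0 d0; have := psize_gt0 n0.
by lia.
Qed.

Lemma fracP (x : F) : exists a b : A, b != 0 /\ x = a%:F / b%:F.
Proof. by exists (fnum x), (fden x); split; [apply: fden_neq0|apply: fnum_fden]. Qed.

Lemma frac_neq0P (x : F) : x != 0 ->
  exists a b : A, [/\ a != 0, b != 0 & x = a%:F / b%:F].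
Proof.
have [a [b [b0 ->]]] := fracP x => x0; exists a, b; split=> //.
by apply: contra_neq x0 => ->; rewrite tofrac0 mul0r.
Qed.

Lemma deg_le0 n : deg_le 0 n.
Proof. by rewrite /deg_le eqxx. Qed.

Lemma deg_leW x m n : deg_le x m -> m <= n -> deg_le x n.
Proof. rewrite /deg_le => /orP[-> //|h] mn; apply/orP; right; lia. Qed.

Lemma deg_leM x y m n : deg_le x m -> deg_le y n -> deg_le (x * y) (m + n).
Proof.
have [->|/frac_neq0P [a [b [a0 b0 ->]]]] := eqVneq x 0; first by move=> *; rewrite mul0r deg_le0.
have [->|/frac_neq0P [c [d [c0 d0 ->]]]] := eqVneq y 0; first by move=> *; rewrite mulr0 deg_le0.
rewrite mulf_div -!tofracM !deg_le_frac ?mulf_neq0 // !psize_mul //.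
have := psize_gt0 a0; have := psize_gt0 b0; have := psize_gt0 c0; have := psize_gt0 d0.
by lia.
Qed.

Lemma deg_leD x y n : deg_le x n -> deg_le y n -> deg_le (x + y) n.
Proof.
have [->|/frac_neq0P [a [b [a0 b0 ->]]]] := eqVneq x 0; first by rewrite add0r.
have [->|/frac_neq0P [c [d [c0 d0 ->]]]] := eqVneq y 0; first by rewrite addr0.
pose S : A := a * d + c * b; pose E : A := b * d.
have -> : a%:F / b%:F + c%:F / d%:F = S%:F / E%:F.
  by rewrite addf_div ?tofrac_eq0 // -!tofracM -tofracD.
have E0 : E != 0 by rewrite mulf_neq0.
have [->|s0] := eqVneq S 0; first by move=> *; rewrite tofrac0 mul0r deg_le0.
rewrite !deg_le_frac //.
have: (psize S <= maxn (psize (a * d)%R) (psize (c * b)%R))%N := psize_add _ _.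
have: psize E = _ := psize_mul b0 d0.
rewrite !psize_mul //.
have := psize_gt0 a0; have := psize_gt0 b0; have := psize_gt0 c0; have := psize_gt0 d0.
by lia.
Qed.

Lemma deg_le_sum I (r : seq I) (P : pred I) (G : I -> F) n :
  (forall i, P i -> deg_le (G i) n) -> deg_le (\sum_(i <- r | P i) G i) n.
Proof.
move=> h; apply: (big_ind (fun z => deg_le z n)) => //; first exact: deg_le0.
by move=> x y hx hy; apply: deg_leD.
Qed.

Lemma deg_leX x m k : deg_le x m -> deg_le (x ^+ k) (m *+ k).
Proof.
move=> hx; elim: k => [|k IH].
  rewrite expr0 mulr0n -tofrac1 -[X in deg_le X]divr1 -tofrac1 deg_le_frac ?oner_neq0 //; lia.
by rewrite exprS mulrS; apply: deg_leM.
Qed.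

Lemma deg_eq_le x n : deg_eq x n -> deg_le x n.
Proof. by case/andP. Qed.

Lemma deg_eq_nle x n m : deg_eq x n -> deg_le x m -> n <= m.
Proof.
case/andP=> _ /negP nle le_m; rewrite leNgt; apply/negP => lt_mn; apply: nle.
by apply: deg_leW le_m _; lia.
Qed.

Lemma deg_eq_neq0 x n : deg_eq x n -> x != 0.
Proof. by case/andP=> _; apply: contraNneq => ->; apply: deg_le0. Qed.

Lemma deg_eq_inj x n m : deg_eq x n -> deg_eq x m -> n = m.
Proof.
move=> h1 h2; apply/eqP; rewrite eq_le.
by rewrite (deg_eq_nle h1 (deg_eq_le h2)) (deg_eq_nle h2 (deg_eq_le h1)).
Qed.

Lemma deg_eq_frac (a b : A) n : a != 0 -> b != 0 ->
  deg_eq (a%:F / b%:F) n = ((psize a)%:Z == (psize b)%:Z + n).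
Proof. by move=> a0 b0; rewrite /deg_eq !deg_le_frac //; lia. Qed.

Lemma deg_eqP x : x != 0 -> exists n, deg_eq x n.
Proof.
move/frac_neq0P => [a [b [a0 b0 ->]]]; exists ((psize a)%:Z - (psize b)%:Z).
rewrite deg_eq_frac //; lia.
Qed.

Lemma deg_leNP x n : ~~ deg_le x n -> exists2 m, deg_eq x m & n < m.
Proof.
move=> nle; have x0 : x != 0 by apply: contraNneq nle => ->; apply: deg_le0.
have [m dm] := deg_eqP x0; exists m => //; rewrite ltNge; apply: contra nle.
by apply: deg_leW; apply: deg_eq_le.
Qed.

Lemma deg_eqM x y m n : deg_eq x m -> deg_eq y n -> deg_eq (x * y) (m + n).
Proof.
move=> hx hy; have /frac_neq0P [a [b [a0 b0 def_x]]] := deg_eq_neq0 hx.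
have /frac_neq0P [c [d [c0 d0 def_y]]] := deg_eq_neq0 hy.
move: hx hy; rewrite {}def_x {}def_y.
rewrite mulf_div -!tofracM !deg_eq_frac ?mulf_neq0 // !psize_mul //.
have := psize_gt0 a0; have := psize_gt0 b0; have := psize_gt0 c0; have := psize_gt0 d0.
by lia.
Qed.

Lemma deg_eq1 : deg_eq 1 0.
Proof. by rewrite -[X in deg_eq X]divr1 -tofrac1 deg_eq_frac ?oner_neq0 // addr0. Qed.

Lemma deg_eqX x m k : deg_eq x m -> deg_eq (x ^+ k) (m *+ k).
Proof.
move=> hx; elim: k => [|k IH]; first by rewrite expr0 mulr0n deg_eq1.
by rewrite exprS mulrS; apply: deg_eqM.
Qed.

Lemma deg_eqV x m : deg_eq x m -> deg_eq x^-1 (- m).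
Proof.
move=> hx; have /frac_neq0P [a [b [a0 b0 def_x]]] := deg_eq_neq0 hx.
move: hx; rewrite {}def_x.
by rewrite invf_div !deg_eq_frac //; lia.
Qed.

Lemma addFF (x : F) : x + x = 0.
Proof. exact: (addxx pcharF). Qed.

Lemma deg_eqD x y n : deg_eq x n -> deg_le y (n - 1) -> deg_eq (x + y) n.
Proof.
case/andP=> lex nlex ley; rewrite /deg_eq; apply/andP; split.
  by apply: deg_leD => //; apply: deg_leW ley _; lia.
apply: contra nlex => les; have -> : x = (x + y) + y by rewrite -addrA addFF addr0.
exact: deg_leD.
Qed.

(* The residue field at infinity is F_2, so equal leading terms cancel. *)
Lemma deg_eqDD x y n : deg_eq x n -> deg_eq y n -> deg_le (x + y) (n - 1).
Proof.
move=> hx hy; have /frac_neq0P [a [b [a0 b0 def_x]]] := deg_eq_neq0 hx.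
have /frac_neq0P [c [d [c0 d0 def_y]]] := deg_eq_neq0 hy.
move: hx hy; rewrite {}def_x {}def_y.
rewrite !deg_eq_frac // => /eqP hx /eqP hy.
pose S : A := a * d + c * b; pose E : A := b * d.
have -> : a%:F / b%:F + c%:F / d%:F = S%:F / E%:F.
  by rewrite addf_div ?tofrac_eq0 // -!tofracM -tofracD.
have E0 : E != 0 by rewrite mulf_neq0.
have [->|s0] := eqVneq S 0; first by move=> *; rewrite tofrac0 mul0r deg_le0.
have lead1 (p : {poly 'F_2}) : p != 0 -> lead_coef p = 1.
  by move=> p0; apply: F2_neq0; rewrite lead_coef_eq0.
rewrite deg_le_frac //.
have ad0 : a * d != 0 by rewrite mulf_neq0.
have cb0 : c * b != 0 by rewrite mulf_neq0.
have sad := psize_mul a0 d0; have scb := psize_mul c0 b0; have sbd : psize E = _ := psize_mul b0 d0.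
have pa := psize_gt0 a0; have pb := psize_gt0 b0; have pc := psize_gt0 c0.
have pd := psize_gt0 d0.
have eqs : psize (a * d) = psize (c * b) by lia.
have lt_s : (psize S < psize (a * d)%R)%N.
  have le_s : (psize S <= psize (a * d)%R)%N.
    by apply: leq_trans (psize_add _ _) _; rewrite eqs maxnn.
  rewrite -[X in (_ < X)%N](prednK (psize_gt0 ad0)) ltnS; apply/leq_sizeP => j.
  rewrite leq_eqVlt => /predU1P[<-|lt_j].
    rewrite coefD.
    have -> : (a * d)`_(psize (a * d)).-1 = 1 := lead1 _ ad0.
    have -> : (c * b)`_(psize (a * d)).-1 = 1 by rewrite eqs; apply: lead1.
    by apply: val_inj.
  apply: nth_default; apply: leq_trans le_s _.
  by rewrite -[X in (X <= _)%N](prednK (psize_gt0 ad0)).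
by lia.
Qed.

Lemma deg_eqDlt x y n m : deg_eq x n -> deg_le y m -> m < n -> deg_eq (x + y) n.
Proof. by move=> hx hy lt_mn; apply: deg_eqD hx (deg_leW hy _); lia. Qed.

Lemma deg_le_tofrac (a : A) (n : nat) : deg_le a%:F n%:Z = (psize a <= n.+1)%N.
Proof.
have [->|a0] := eqVneq a 0; first by rewrite tofrac0 deg_le0 /psize size_poly0.
rewrite -[X in deg_le X]divr1 -tofrac1 deg_le_frac ?oner_neq0 //.
by rewrite psize1; lia.
Qed.

Lemma deg_eq_tofrac_ge0 (a : A) n : deg_eq a%:F n -> 0 <= n.
Proof.
move=> h; have a0 : a != 0 by rewrite -tofrac_eq0 (deg_eq_neq0 h).
move: h; rewrite -[X in deg_eq X]divr1 -tofrac1 deg_eq_frac ?oner_neq0 //.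
by have := psize_gt0 a0; rewrite psize1; lia.
Qed.

Lemma deg_eq_Tvar : deg_eq Tvar 1.
Proof.
by rewrite /Tvar -[X in deg_eq X]divr1 -tofrac1 deg_eq_frac ?oner_neq0 ?polyX_eq0 // /psize size_polyX size_poly1.
Qed.

(** * Newton polygons of an isogeny *)

Section PolynomialAction.
Variables (R : comNzRingType) (rho : {rmorphism {poly 'F_2} -> R}) (P : R -> R).
Hypothesis P_add : forall x y, P (x + y) = P x + P y.

Implicit Types (a b : {poly 'F_2}).

Definition poly_act a y :=
  \sum_(i < size a) rho (a`_i)%:P * iter i P y.

Lemma poly_actE n a y : (size a <= n)%N ->
  poly_act a y = \sum_(i < n) rho (a`_i)%:P * iter i P y.
Proof.
move=> le_an; rewrite /poly_act (big_ord_widen n (fun i => rho (a`_i)%:P * iter i P y) le_an).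
rewrite [RHS](bigID (fun i : 'I_n => (i < size a)%N)) /= [X in _ + X]big1 ?addr0 //.
by move=> i; rewrite -leqNgt => /(nth_default 0) ->; rewrite polyC0 rmorph0 mul0r.
Qed.

Lemma P_zero : P 0 = 0.
Proof. by apply: (addrI (P 0)); rewrite -P_add !addr0. Qed.

Lemma P_scale (c : 'F_2) x : P (rho c%:P * x) = rho c%:P * P x.
Proof.
by case: (F2_cases c) => ->; rewrite ?polyC0 ?polyC1 ?rmorph0 ?rmorph1 ?mul0r ?mul1r // P_zero.
Qed.

Lemma iter_P_add i x y : iter i P (x + y) = iter i P x + iter i P y.
Proof. by elim: i => //= i ->; rewrite P_add. Qed.

Lemma poly_actD a b y : poly_act (a + b) y = poly_act a y + poly_act b y.
Proof.
pose n := maxn (size a) (size b).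
rewrite !(@poly_actE n) ?leq_maxl ?leq_maxr //; last exact: size_polyD.
by rewrite -big_split; apply: eq_bigr => i _; rewrite coefD polyCD rmorphD mulrDl.
Qed.

Lemma poly_act0 y : poly_act 0 y = 0.
Proof. by rewrite /poly_act size_poly0 big_ord0. Qed.

Lemma poly_actC (c : 'F_2) y : poly_act c%:P y = rho c%:P * y.
Proof. by rewrite (@poly_actE 1) ?size_polyC_leq1 // big_ord1 coefC. Qed.

Lemma poly_act1 y : poly_act 1 y = y.
Proof. by rewrite -polyC1 poly_actC polyC1 rmorph1 mul1r. Qed.

Lemma P_sum I (r : seq I) (Q : pred I) (G : I -> R) :
  P (\sum_(j <- r | Q j) G j) = \sum_(j <- r | Q j) P (G j).
Proof. by apply: (big_morph P) => [x y|]; [apply: P_add|apply: P_zero]. Qed.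

Lemma poly_actMX a y : poly_act (a * 'X) y = P (poly_act a y).
Proof.
rewrite (@poly_actE (size a).+1); last first.
  by apply: leq_trans (size_polyMleq _ _) _; rewrite size_polyX addn2.
rewrite big_ord_recl coefMX polyC0 rmorph0 mul0r add0r P_sum.
by apply: eq_bigr => i _; rewrite P_scale coefMX.
Qed.

Lemma poly_act_add a x y : poly_act a (x + y) = poly_act a x + poly_act a y.
Proof. by rewrite -big_split; apply: eq_bigr => i _; rewrite iter_P_add mulrDr. Qed.

Lemma poly_act_at0 a : poly_act a 0 = 0.
Proof. by apply: (addrI (poly_act a 0)); rewrite -poly_act_add !addr0. Qed.

Lemma poly_actM a b y : poly_act (a * b) y = poly_act a (poly_act b y).
Proof.
elim/poly_ind: a => [|a c IH]; first by rewrite mul0r !poly_act0.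
rewrite mulrDl !poly_actD mulrAC !poly_actMX IH poly_actC; congr (_ + _).
case: (F2_cases c) => ->; first by rewrite polyC0 mul0r poly_act0 rmorph0 mul0r.
by rewrite polyC1 mul1r rmorph1 mul1r.
Qed.

Lemma poly_actX y : poly_act 'X y = P y.
Proof. by rewrite -['X]mul1r poly_actMX poly_act1. Qed.

End PolynomialAction.

(** The coefficients of [a] are 0 or 1, so an additive [f] is automatically linear for them. *)
Lemma poly_act_intertwine (R S : comNzRingType) (rho : {rmorphism {poly 'F_2} -> R})
    (sigma : {rmorphism {poly 'F_2} -> S}) (P : R -> R) (Q : S -> S) (f : R -> S) :
    (forall x y, f (x + y) = f x + f y) -> (forall x, f (P x) = Q (f x)) ->
  forall a y, f (poly_act rho P a y) = poly_act sigma Q a (f y).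
Proof.
move=> f_add fP a y; have f0 : f 0 = 0 by apply: (addrI (f 0)); rewrite -f_add !addr0.
rewrite /poly_act (big_morph f f_add f0); apply: eq_bigr => i _.
have -> : iter i Q (f y) = f (iter i P y) by elim: (i : nat) => //= k ->; rewrite fP.
case: (F2_cases a`_i) => ->; rewrite ?polyC0 ?polyC1 ?rmorph0 ?rmorph1 ?mul0r ?mul1r //.
Qed.

Definition pow2 (i : nat) : int := (2 ^ i)%N%:Z.

Lemma pow2S i : pow2 i.+1 = 2 * pow2 i.
Proof. by rewrite /pow2 expnS PoszM. Qed.

Lemma pow2_gt0 i : 1 <= pow2 i.
Proof. by rewrite /pow2; have := expn_gt0 2 i; lia. Qed.

Lemma pow2_0 : pow2 0 = 1.
Proof. by []. Qed.

Lemma mulrn_pow2 (m : int) i : m *+ (2 ^ i) = m * pow2 i.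
Proof. by rewrite -mulr_natr natz. Qed.

Lemma deg_le_frob x m i : deg_le x m -> deg_le (x ^+ (2 ^ i)) (m * pow2 i).
Proof. by move=> /(deg_leX (2 ^ i)); rewrite mulrn_pow2. Qed.

Lemma deg_eq_frob x m i : deg_eq x m -> deg_eq (x ^+ (2 ^ i)) (m * pow2 i).
Proof. by move=> /(deg_eqX (2 ^ i)); rewrite mulrn_pow2. Qed.

Lemma deg_le_sq x m : deg_le x m -> deg_le (x ^+ 2) (2 * m).
Proof. by move=> /(deg_leX 2); rewrite mulr2n; congr deg_le; lia. Qed.

Lemma deg_le_pow4 x m : deg_le x m -> deg_le (x ^+ 4) (4 * m).
Proof. by move=> /(deg_leX 4); congr deg_le; rewrite -mulr_natr natz; lia. Qed.

Lemma deg_leA (a : A) : exists n : nat, deg_le a%:F n%:Z.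
Proof. by exists (psize a); rewrite deg_le_tofrac. Qed.

Lemma addF_move (x y z : F) : x + y = z -> x = z + y.
Proof. by move=> <-; rewrite -addrA addFF addr0. Qed.

(** The ultrametric inequality as a refutation: one term of an identity strictly dominates all the
    others. *)
Lemma deg_eq_sum_contra (x : F) (s : seq F) h :
  x = \sum_(y <- s) y -> deg_eq x h -> all (fun y => deg_le y (h - 1)) s -> False.
Proof.
move=> def_x hx /allP hs; have: deg_le x (h - 1).
  by rewrite def_x big_seq_cond; apply: deg_le_sum => y /andP[/hs].
by move/(deg_eq_nle hx); lia.
Qed.

(** * Isogenies with u_0 = 1 at the place infinity *)

Section ArithmeticCore.

Variables (d : nat) (u : nat -> F) (g g' : F).
Hypothesis d_gt1 : (1 < d)%N.
Hypothesis u_0 : u 0%N = 1.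
Hypothesis u_d : u d = 1.
Hypothesis u_gt : forall i, (d < i)%N -> u i = 0.
Hypothesis u_int : forall i, exists a : A, u i = a%:F.

(** This is u_(k-1), zero at k = 0, so that [isog_rec k] is the coefficient of tau^(k+1) in u phi_T
    = phi'_T u. *)
Definition pred_coef k := if k is k'.+1 then u k' else 0.

Hypothesis isog_rec : forall k,
  u k.+1 * Tvar ^+ (2 ^ k.+1) + u k * g ^+ (2 ^ k) + pred_coef k =
  Tvar * u k.+1 + g' * u k ^+ 2 + pred_coef k ^+ 4.

(** The Newton polygon with points (2^i, deg u_i) lies below some line of integral slope through its
    first point (1, 0). *)
Lemma u_deg_bound : exists n : nat, forall i, deg_le (u i) (n%:Z * (pow2 i - 1)).
Proof.
have bnd k : exists n : nat, forall i, (i < k)%N -> deg_le (u i) (n%:Z * (pow2 i - 1)).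
  elim: k => [|k [n IH]]; first by exists 0%N.
  have [a def_a] := u_int k; have [b le_b] := deg_leA a.
  exists (maxn n b) => i; rewrite ltnS leq_eqVlt => /predU1P[->|lt_ik].
    case: k def_a {IH} => [|k] def_a.
      by rewrite u_0; apply: deg_leW (deg_eq_le deg_eq1) _; rewrite pow2_0; lia.
    by rewrite def_a; apply: deg_leW le_b _; have := pow2_gt0 k; rewrite pow2S; nia.
  by apply: deg_leW (IH i lt_ik) _; have := pow2_gt0 i; nia.
have [n hn] := bnd d.+1; exists n => i; case: (leqP i d) => [le_id|lt_di].
  exact: hn.
by rewrite u_gt // deg_le0.
Qed.

Lemma u_deg_min : exists n : nat,
  (forall i, deg_le (u i) (n%:Z * (pow2 i - 1))) /\
  exists2 i, (0 < i <= d)%N & ~~ deg_le (u i) ((n%:Z - 1) * (pow2 i - 1)).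
Proof.
pose P n := [forall i : 'I_d.+1, deg_le (u i) (n%:Z * (pow2 i - 1))].
have exP : exists n, P n.
  by have [n hn] := u_deg_bound; exists n; apply/forallP => i.
case: (ex_minnP exP) => n /forallP Pn min_n; exists n; split.
  move=> i; case: (leqP i d) => [le_id|lt_di]; last by rewrite u_gt // deg_le0.
  by have := Pn (inord i); rewrite inordK.
case: n Pn min_n => [|n] _ min_n.
  (* For n = 0 the index [d] fails: u_d = 1 has degree 0, above -(2^d - 1). *)
  exists d; first by rewrite leqnn (ltnW d_gt1).
  apply/negP; rewrite u_d => /(deg_eq_nle deg_eq1).
  have /prednK <- : (0 < d)%N by apply: ltnW.
  by rewrite pow2S; have := pow2_gt0 d.-1; lia.
have /forallPn [i nle] : ~~ P n by apply/negP => /min_n; rewrite ltnn.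
exists i; last by move: nle; congr (~~ deg_le _ (_ * _)); lia.
rewrite lt0n leq_ord andbT; apply: contra nle => /eqP ->.
by rewrite u_0 pow2_0 subrr mulr0 (deg_eq_le deg_eq1).
Qed.

(** [I] is the last index attaining the Gauss norm at radius [c]; the strict inequality beyond [I]
    later isolates a dominant term. *)
Lemma u_argmax c : exists I h, [/\ (I <= d)%N, deg_eq (u I) h &
  forall j hj, deg_eq (u j) hj ->
    hj + pow2 j * c <= h + pow2 I * c /\
    ((I < j)%N -> hj + pow2 j * c < h + pow2 I * c)].
Proof.
pose D : int := d.+1%:Z.
have dgP (i : nat) : exists h, (u i != 0) ==> deg_eq (u i) h.
  have [->|/deg_eqP [h hh]] := eqVneq (u i) 0; first by exists 0.
  by exists h; apply/implyP.
pose dg (i : nat) := xchoose (dgP i).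
have dgE i : u i != 0 -> deg_eq (u i) (dg i) by apply/implyP: (xchooseP (dgP i)).
(* A lexicographic order in one integer: as i < D, maximizing [V] maximizes the norm and breaks ties
   towards the larger index. *)
pose V (i : 'I_d.+1) : int := (dg i + pow2 i * c) * D + (i : nat)%:Z.
have ud0 : u (@ord_max d) != 0 by rewrite /= u_d oner_neq0.
case: (@Order.TotalTheory.arg_maxP _ _ _ ord_max (fun i : 'I_d.+1 => u i != 0) V ud0).
move=> I uI maxI; exists I, (dg I); split; first by rewrite -ltnS.
  exact: dgE.
move=> j hj hu; have uj := deg_eq_neq0 hu.
have le_jd : (j <= d)%N by rewrite leqNgt; apply: contra uj => /u_gt ->.
have := maxI (inord j); rewrite /V /= inordK // => /(_ uj).
rewrite -(deg_eq_inj hu (dgE _ uj)) /D.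
have := ltn_ord I; move: le_jd; set wj := hj + _; set wI := dg I + _.
by move=> *; split; nia.
Qed.

Lemma deg_le_neq0 x n : (forall h, deg_eq x h -> h <= n) -> deg_le x n.
Proof.
move=> hx; have [->|/deg_eqP [h hh]] := eqVneq x 0; first exact: deg_le0.
by apply: deg_leW (deg_eq_le hh) (hx _ hh).
Qed.

(* With [U s] the Gauss norm of [u] at radius [s] and [Phi], [Phi'] those of the two
   Drinfeld modules, [U (Phi s) = Phi' (U s)]. Let [-n] be the largest integer [s] with
   [U s = s]; then [U (Phi s) > Phi s] while [Phi' (U s) = Phi' s]. *)
Lemma deg_target_not_le : ~ (forall n, deg_le g n -> deg_le g' n).
Proof.
move=> le_gg'; have [n [hU [i0 /andP[i0_gt0 le_i0d] hX]]] := u_deg_min.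
have [h0 hu0 lt_h0] := deg_leNP hX.
have pi0 : 2 <= pow2 i0.
  by case: (i0) i0_gt0 => // i _; rewrite pow2S; have := pow2_gt0 i; lia.
have n0 : 0 <= n%:Z by [].
(* If deg g <= n, the norm of phi_T at -n is 1 - n, attained by T alone. At a maximal index I for
   this radius, u_I T^(2^I) dominates the coefficient identity. *)
have [le_gn|] := boolP (deg_le g n%:Z).
  have le_g'n := le_gg' _ le_gn.
  have [I [h [le_Id hI maxI]]] := u_argmax (1 - n%:Z).
  have W : 2 - n%:Z <= h + pow2 I * (1 - n%:Z) by have [] := maxI _ _ hu0; nia.
  case: I le_Id hI maxI W => [|I] le_Id hI maxI W.
    have := deg_eq_inj hI; rewrite u_0 => /(_ _ deg_eq1) h00.
    by move: W; rewrite h00 pow2_0; lia.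
  have pI := pow2_gt0 I; have pIS := pow2S I; set P := pow2 I in pI pIS.
  have hT := deg_eqM hI (deg_eq_frob I.+1 deg_eq_Tvar).
  apply: (@deg_eq_sum_contra _ [:: u I * g ^+ (2 ^ I); pred_coef I; Tvar * u I.+1;
      g' * u I ^+ 2; pred_coef I ^+ 4] _ _ hT).
    rewrite !big_cons big_nil addr0.
    by have := isog_rec I => /addF_move/addF_move ->; ring.
  rewrite pIS in W *; rewrite /= andbT; apply/and5P; split.
  - have [->|/deg_eqP [h1 hh1]] := eqVneq (u I) 0; first by rewrite mul0r deg_le0.
    apply: deg_leW (deg_leM (deg_eq_le hh1) (deg_le_frob I le_gn)) _.
    by have [] := maxI _ _ hh1; rewrite pIS -/P; nia.
  - case: I @P pI pIS maxI {le_Id hI hT} W => [|I] P pI pIS maxI W; first exact: deg_le0.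
    apply: deg_le_neq0 => h1 hh1; have [] := maxI _ _ hh1.
    by move: pI W; rewrite pIS /P pow2S; have := pow2_gt0 I; nia.
  - by apply: deg_leW (deg_leM (deg_eq_le deg_eq_Tvar) (deg_eq_le hI)) _; lia.
  - apply: deg_leW (deg_leM le_g'n (deg_le_sq (hU I))) _; rewrite -/P; nia.
  case: I @P pI pIS maxI {le_Id hI hT} W => [|I] P pI pIS maxI W.
    by rewrite /= expr0n deg_le0.
  apply: deg_leW (deg_le_pow4 (hU I)) _.
  by move: pI W; rewrite /P pow2S; have := pow2_gt0 I; nia.
(* If deg g = m > n, the norm of phi_T at -n is m - 2 n, and T ties with g when m = n + 1. As I is
   the last maximal index, u_(I+1) is small enough for u_I g^(2^I) to dominate. *)
move/deg_leNP => [m hm lt_nm].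
have le_g'm := le_gg' _ (deg_eq_le hm).
have [I [h [le_Id hI maxI]]] := u_argmax (m - 2 * n%:Z).
have W : m - 2 * n%:Z + 1 <= h + pow2 I * (m - 2 * n%:Z) by have [] := maxI _ _ hu0; nia.
have pI := pow2_gt0 I; have pIS := pow2S I.
have hT := deg_eqM hI (deg_eq_frob I hm).
have leS : deg_le (u I.+1) (h + m * pow2 I - 2 * pow2 I - 1).
  apply: deg_le_neq0 => h1 hh1; have [_ /(_ (leqnn _))] := maxI _ _ hh1.
  by rewrite pIS; nia.
have I_gt0 : (0 < I)%N.
  case: I hI W {le_Id maxI pI pIS hT leS} => // hI W.
  have := deg_eq_inj hI; rewrite u_0 => /(_ _ deg_eq1) h00.
  by move: W; rewrite h00 pow2_0; lia.
case: I I_gt0 le_Id hI maxI W pI pIS hT leS => // I _ le_Id hI maxI W pI pIS hT leS.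
apply: (@deg_eq_sum_contra _ [:: u I.+2 * Tvar ^+ (2 ^ I.+2); u I; Tvar * u I.+2;
    g' * u I.+1 ^+ 2; u I ^+ 4] _ _ hT).
  rewrite !big_cons big_nil addr0.
  by have := isog_rec I.+1 => /addF_move; rewrite addrC => /addF_move -> /=; ring.
have pJ := pow2_gt0 I; have pJS := pow2S I.
rewrite /= andbT; apply/and5P; split.
- apply: deg_leW (deg_leM leS (deg_le_frob I.+2 (deg_eq_le deg_eq_Tvar))) _.
  by rewrite pIS; lia.
- apply: deg_le_neq0 => h1 hh1; have [] := maxI _ _ hh1.
  by rewrite pJS; clear -pJ lt_nm n0; nia.
- by apply: deg_leW (deg_leM (deg_eq_le deg_eq_Tvar) leS) _; lia.
- by apply: deg_leW (deg_leM le_g'm (deg_le_sq (hU I.+1))) _; nia.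
apply: deg_leW (deg_le_pow4 (hU I)) _.
by move: W; rewrite pJS; nia.
Qed.

Lemma deg_target : exists2 m', deg_eq g' m' & deg_le g (m' - 1).
Proof.
have [g'0|/deg_eqP [m' hm']] := eqVneq g' 0.
  by case: deg_target_not_le => n _; rewrite g'0 deg_le0.
exists m' => //; apply: contraT => nle; case: deg_target_not_le => n le_gn.
apply: deg_leW (deg_eq_le hm') _; rewrite leNgt; apply: contra nle => lt_nm.
by apply: deg_leW le_gn _; lia.
Qed.

Lemma u1_deg : exists h : nat,
  [/\ deg_eq g' (h%:Z + 2), deg_le g (h%:Z + 1), deg_eq (u 1%N) h%:Z &
      forall i, (1 < i)%N -> deg_le (u i) (h%:Z * (pow2 i - 1) - 1)].
Proof.
have [m' hm' le_g] := deg_target.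
have hTT : deg_eq (Tvar ^+ 2 + Tvar) 2.
  by apply: (deg_eqDlt (m := 1)) => //; [apply: (deg_eqX 2 deg_eq_Tvar)|apply: deg_eq_le deg_eq_Tvar].
have E : u 1%N * (Tvar ^+ 2 + Tvar) = g' + g.
  have := isog_rec 0; rewrite /= u_0 !mul1r expr1n mulr1 !expr1 expr0n /= !addr0 => E.
  by rewrite mulrDr (addF_move E) [Tvar * _]mulrC addrC addrA addrA addFF add0r.
have hg'g : deg_eq (g' + g) m' by apply: deg_eqD.
have u1_neq0 : u 1%N != 0.
  by apply: contraTneq (deg_eq_neq0 hg'g) => u10; rewrite -E u10 mul0r eqxx.
have [h1 hu1] := deg_eqP u1_neq0.
have hm : m' = h1 + 2.
  by apply: (deg_eq_inj hg'g); rewrite -E; apply: deg_eqM.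
have h1_ge0 : 0 <= h1 by have [a def_a] := u_int 1; move: hu1; rewrite def_a => /deg_eq_tofrac_ge0.
case: h1 h1_ge0 hu1 hm => // h _ hu1 hm; exists h.
rewrite -hm; split=> //; first by apply: deg_leW le_g _; lia.
have h0 : 0 <= h%:Z by [].
(* Two consecutive bounds are carried because [isog_rec] links three coefficients. The saving of 1,
   switched on by [(0 < k)], starts at index i = 2, where 2^i - 1 absorbs the 2 in deg g' = h +
   2. *)
have key k : deg_le (u k) (h%:Z * (pow2 k - 1)) /\ deg_le (u k.+1) (h%:Z * (pow2 k.+1 - 1) - (0 < k)%N%:Z).
  elim: k => [|k [IH0 IH1]].
    rewrite u_0 pow2S pow2_0; split; first by apply: deg_leW (deg_eq_le deg_eq1) _; lia.
    by apply: deg_leW (deg_eq_le hu1) _; lia.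
  split; first by apply: deg_leW IH1 _; lia.
  rewrite /=.
  have hpT : deg_eq (Tvar ^+ (2 ^ k.+2)) (1 * pow2 k.+2) by apply: deg_eq_frob deg_eq_Tvar.
  have hTk : deg_eq (Tvar ^+ (2 ^ k.+2) + Tvar) (pow2 k.+2).
    move: hpT; rewrite mul1r => hpT; apply: (deg_eqDlt hpT (deg_eq_le deg_eq_Tvar)).
    by rewrite !pow2S; have := pow2_gt0 k; clear; lia.
  have p1 := pow2_gt0 k; have p2 := pow2S k; have p3 := pow2S k.+1.
  have IH1' : deg_le (u k.+1) (h%:Z * (pow2 k.+1 - 1)) by apply: deg_leW IH1 _; clear; lia.
  have Ek : u k.+2 * (Tvar ^+ (2 ^ k.+2) + Tvar) =
      u k.+1 * g ^+ (2 ^ k.+1) + u k + g' * u k.+1 ^+ 2 + u k ^+ 4.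
    have /addF_move/addF_move := isog_rec k.+1; rewrite mulrDr /= => ->.
    by rewrite [Tvar * _]mulrC addrC !addrA addFF add0r; ring.
  have le_E : deg_le (u k.+2 * (Tvar ^+ (2 ^ k.+2) + Tvar))
     (h%:Z * (pow2 k.+2 - 1) - 1 + pow2 k.+2).
    rewrite Ek; apply: deg_leD; first apply: deg_leD; first apply: deg_leD.
    - apply: deg_leW (deg_leM IH1' (deg_le_frob k.+1 le_g)) _.
      by rewrite hm p3; clear -p1 p2 p3 h0; nia.
    - by apply: deg_leW IH0 _; rewrite p3 p2; clear -p1 p2 p3 h0; nia.
    - apply: deg_leW (deg_leM (deg_eq_le hm') (deg_le_sq IH1')) _.
      by rewrite hm p3 p2; clear -p1 p2 p3 h0; nia.
    by apply: deg_leW (deg_le_pow4 IH0) _; rewrite p3 p2; clear -p1 p2 p3 h0; nia.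
  apply: deg_le_neq0 => hk hhk; have := deg_eq_nle (deg_eqM hhk hTk) le_E; clear; lia.
by case=> [|[|i]] // _; have [_] := key i.+1.
Qed.

Definition ueval y := \sum_(i < d.+1) u i * y ^+ (2 ^ i).

Definition phi y := Tvar * y + g * y ^+ 2 + y ^+ 4.
Definition phi' y := Tvar * y + g' * y ^+ 2 + y ^+ 4.

Lemma ueval_add x y : ueval (x + y) = ueval x + ueval y.
Proof. by rewrite -big_split; apply: eq_bigr => i _; rewrite (frobD pcharF) mulrDr. Qed.

Lemma ueval_split y :
  ueval y = y + (u 1%N * y ^+ 2 + \sum_(i < d.-1) u i.+2 * y ^+ (2 ^ i.+2)).
Proof.
have d_pred : d.+1 = d.-1.+2 by case: (d) d_gt1.
by rewrite /ueval d_pred !big_ord_recl /= u_0 mul1r expr1.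
Qed.

(** Below the break, [ueval] is the identity up to terms smaller by one degree; this makes the
    Newton step a contraction. *)
Lemma ueval_tail y n h : deg_eq (u 1%N) h%:Z ->
    (forall i, (1 < i)%N -> deg_le (u i) (h%:Z * (pow2 i - 1) - 1)) ->
    1 <= n -> deg_le y (- h%:Z - n) ->
  deg_le (u 1%N * y ^+ 2 + \sum_(i < d.-1) u i.+2 * y ^+ (2 ^ i.+2)) (- h%:Z - n - 1).
Proof.
move=> hu1 hu n1 hy; apply: deg_leD.
  by apply: deg_leW (deg_leM (deg_eq_le hu1) (deg_le_sq hy)) _; lia.
apply: deg_le_sum => i _.
apply: deg_leW (deg_leM (hu i.+2 isT) (deg_le_frob i.+2 hy)) _.
by rewrite !pow2S; have := pow2_gt0 i; clear -n1; nia.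
Qed.

(* Newton iteration for the root of [u] of smallest degree at infinity. *)
Lemma approx_root h : deg_eq (u 1%N) h%:Z ->
    (forall i, (1 < i)%N -> deg_le (u i) (h%:Z * (pow2 i - 1) - 1)) ->
  forall k : nat, exists y, deg_eq y (- h%:Z) /\ deg_le (ueval y) (- h%:Z - 1 - k%:Z).
Proof.
move=> hu1 hu; elim=> [|k [y [hy le_uy]]].
  (* At 1 / u_1 the terms y and u_1 y^2 cancel. *)
  exists (u 1%N)^-1; split; first exact: deg_eqV.
  rewrite ueval_split expr2 mulVKf ?(deg_eq_neq0 hu1) // addrA addFF add0r.
  apply: deg_le_sum => i _.
  apply: deg_leW (deg_leM (hu i.+2 isT) (deg_le_frob i.+2 (deg_eq_le (deg_eqV hu1)))) _.
  by clear; lia.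
(* The derivative of [ueval] is u_0 = 1, so the Newton correction is [ueval y] itself; by additivity
   the new error is the tail evaluated at the old error. *)
exists (y + ueval y); split.
  by apply: deg_eqDlt hy le_uy _; clear; lia.
rewrite ueval_add [ueval (ueval y)]ueval_split addrA addFF add0r.
have := @ueval_tail (ueval y) (1 + k%:Z) h hu1 hu.
by move=> tail; apply: deg_leW (tail _ _) _; [clear; lia|apply: deg_leW le_uy _; clear; lia|clear; lia].
Qed.

Lemma phi_add x y : phi (x + y) = phi x + phi y.
Proof.
rewrite /phi -[2%N]/(2 ^ 1)%N -[4%N]/(2 ^ 2)%N !(frobD pcharF); ring.
Qed.

Lemma pow2_neq3M k (M : int) : pow2 k != 3 * M.
Proof.
apply/negP => /eqP E.
have: (3 %| 2 ^ k)%N.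
  have M0 : 0 <= M by have := pow2_gt0 k; lia.
  by case: M E M0 => // m; rewrite /pow2 -PoszM => -[->] _; rewrite dvdn_mulr.
by rewrite Euclid_dvdX //.
Qed.

(** * Growth of degrees under iteration of phi_T *)

Section Escape.
Variable M : int.
Hypotheses (M_ge1 : 1 <= M) (le_gM : deg_le g M) (eq_gM : M = 1 \/ deg_eq g M).

(** The first alternative persists while g z^2 dominates and f + M doubles; the second holds once
    z^4 dominates and f is multiplied by 4. *)
Definition escaping z f := deg_eq z f /\
  ((exists2 k, f + M = pow2 k.+1 & True) \/ (1 <= f /\ M < 2 * f)).

Lemma escaping_step z f : escaping z f -> exists2 f', f < f' & escaping (phi z) f'.
Proof.
case=> hz alt; have z2 := deg_eqX 2 hz; have z4 := deg_eqX 4 hz.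
have Tz := deg_eqM deg_eq_Tvar hz.
have [lt_Mf|le_fM] := ltP M (2 * f).
  exists (4 * f); first by clear -lt_Mf M_ge1; lia.
  split; last by right; clear -lt_Mf M_ge1; lia.
  rewrite /phi addrC; apply: (deg_eqDlt (m := 4 * f - 1)); last by clear; lia.
    by rewrite (_ : 4 * f = f *+ 4) //; clear; lia.
  apply: deg_leD; first by apply: deg_leW (deg_eq_le Tz) _; clear -lt_Mf M_ge1; lia.
  apply: deg_leW (deg_leM le_gM (deg_eq_le z2)) _; clear -lt_Mf M_ge1; lia.
case: alt => [[k Ek _]|[]]; last by move=> _; rewrite ltNge le_fM.
have pk := pow2_gt0 k; have pkS := pow2S k.
(* A tie between g z^2 and z^4 would give 3 M = 2 (f + M), a power of 2. *)
have ne : 2 * f <> M.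
  move=> E; have := pow2_neq3M k.+2 M; rewrite pow2S -Ek -E => /eqP; apply.
  by clear; lia.
have lt_fM : 2 * f < M by clear -le_fM ne; lia.
(* With M = 1, f + M = 2^(k+1) would force f >= 1, against 2 f < M. *)
have gM : deg_eq g M.
  by case: eq_gM => // M1; exfalso; clear -M1 Ek pk pkS lt_fM; lia.
exists (M + 2 * f); first by clear -M_ge1 Ek pk pkS; lia.
split; last by left; exists k.+1 => //; rewrite pow2S -Ek; clear; lia.
have gz := deg_eqM gM z2.
rewrite /phi [Tvar * z + _]addrC -addrA; apply: (deg_eqDlt (m := M + 2 * f - 1)).
- by rewrite (_ : M + 2 * f = M + f *+ 2) //; clear; lia.
- apply: deg_leD; first by apply: deg_leW (deg_eq_le Tz) _; clear -Ek pk pkS; lia.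
  by apply: deg_leW (deg_eq_le z4) _; clear -lt_fM; lia.
by clear; lia.
Qed.

Lemma escaping_iter z f j : escaping z f ->
  exists2 f', f + j%:Z <= f' & escaping (iter j phi z) f'.
Proof.
move=> ez; elim: j => [|j [f1 le1 e1]]; first by exists f => //; clear; lia.
have [f2 lt2 e2] := escaping_step e1; exists f2 => //.
by clear -le1 lt2; lia.
Qed.

Lemma phi_stay z : deg_le z (1 - M) -> deg_le (phi z) (2 - M).
Proof.
move=> hz; rewrite /phi; apply: deg_leD; first apply: deg_leD.
- by apply: deg_leW (deg_leM (deg_eq_le deg_eq_Tvar) hz) _; clear; lia.
- by apply: deg_leW (deg_leM le_gM (deg_le_sq hz)) _; clear; lia.
by apply: deg_leW (deg_le_pow4 hz) _; clear -M_ge1; lia.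
Qed.

(* A first iterate above degree [1 - M] has degree [2^1 - M]; from there on the degrees
   are [2^k - M] and miss the only cancellation value [M / 2], as [3 M] is not a power of 2. *)
Lemma iterates_stay y (B N : nat) : deg_le y (1 - M) ->
    (forall n, (n <= N + B + `|M|)%N -> deg_le (iter n phi y) B%:Z) ->
  forall n, (n <= N)%N -> deg_le (iter n phi y) (1 - M).
Proof.
move=> hy bnd; elim=> [//|n IH] lt_nN.
have le2 := phi_stay (IH (ltnW lt_nN)).
apply: contraT => nle.
have [f hf lt_f] := deg_leNP nle.
have f2 : f = 2 - M by have := deg_eq_nle hf le2; clear -lt_f; lia.
have e0 : escaping (iter n.+1 phi y) f.
  by split=> //; left; exists 0%N => //; rewrite f2 pow2S pow2_0; clear; lia.
(* That many further steps raise the degree from 2 - M beyond B. *)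
have [f' le_f' [hf' _]] := escaping_iter (B + `|M|) e0.
have := deg_eq_nle hf' (_ : deg_le _ B%:Z); rewrite -iterD.
have -> : deg_le (iter (B + `|M| + n.+1) phi y) B by apply: bnd; clear -lt_nN; lia.
by move/(_ isT); clear -le_f' f2 M_ge1; lia.
Qed.
End Escape.

(** Beyond the degrees of all coefficients the monic term z^(2^d) dominates. Asking only for a small
    value of [ueval] lets the bound serve approximate roots too. *)
Lemma ueval_bounded : exists B : nat, forall z, deg_le (ueval z) (-1) -> deg_le z B%:Z.
Proof.
have [n hn] := u_deg_bound; exists (n * 2 ^ d)%N => z le_uz.
set B : int := (n * 2 ^ d)%N%:Z.
have leB i : (i <= d)%N -> deg_le (u i) B.
  move=> le_id; apply: deg_leW (hn i) _; rewrite /B PoszM.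
  have := pow2_gt0 i; have : pow2 i <= pow2 d by rewrite /pow2 lez_nat leq_exp2l.
  by rewrite -/(pow2 d); clear; nia.
have B0 : 0 <= B by [].
apply: deg_le_neq0 => f hf; rewrite leNgt; apply/negP => lt_Bf.
have: deg_eq (ueval z) (f * pow2 d).
  rewrite /ueval big_ord_recr /= u_d mul1r addrC.
  apply: (deg_eqDlt (m := f * pow2 d - 1)); first exact: deg_eq_frob.
    apply: deg_le_sum => i _.
    apply: deg_leW (deg_leM (leB i (ltnW (ltn_ord i))) (deg_le_frob i (deg_eq_le hf))) _.
    have : pow2 i.+1 <= pow2 d by rewrite /pow2 lez_nat leq_exp2l.
    by have := pow2_gt0 i; rewrite pow2S; clear -lt_Bf B0; nia.
  by clear; lia.
move/deg_eq_nle => /(_ _ le_uz); have := pow2_gt0 d; clear -lt_Bf B0; nia.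
Qed.

Hypothesis ueval_phi : forall y, ueval (phi y) = phi' (ueval y).
(** [V] will be evaluation of the dual isogeny v, and [Cv] a bound on the degrees of its
    coefficients. *)
Variables (p : {poly 'F_2}) (V : F -> F) (Cv : nat).
Hypothesis p_irr : irreducible_poly p.
Hypothesis p_size : size p = d.+1.
Hypothesis V_bound : forall z n, n <= 0 -> deg_le z n -> deg_le (V z) (n + Cv%:Z).

Let act : {poly 'F_2} -> F -> F := poly_act (@FracField.tofrac {poly 'F_2}) phi.
Let act' : {poly 'F_2} -> F -> F := poly_act (@FracField.tofrac {poly 'F_2}) phi'.

Hypothesis V_ueval : forall y, act p y = V (ueval y).

Lemma ueval_act a y : ueval (act a y) = act' a (ueval y).
Proof. by apply: poly_act_intertwine; [apply: ueval_add|apply: ueval_phi]. Qed.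

(** On small enough elements T z governs the growth, one degree per application, for g and g'
    alike. *)
Lemma phi_small G z (k b : int) : deg_le G b -> b - 1 <= k -> 0 <= k -> deg_le z (- k) ->
  deg_le (Tvar * z + G * z ^+ 2 + z ^+ 4) (- k + 1).
Proof.
move=> hG le_bk k0 hz; apply: deg_leD; first apply: deg_leD.
- by apply: deg_leW (deg_leM (deg_eq_le deg_eq_Tvar) hz) _; clear; lia.
- by apply: deg_leW (deg_leM hG (deg_le_sq hz)) _; clear -le_bk; lia.
by apply: deg_leW (deg_le_pow4 hz) _; clear -k0; lia.
Qed.

Lemma iter_phi_small G z (k b : int) j : deg_le G b -> b + j%:Z <= k -> j%:Z <= k ->
    deg_le z (- k) ->
  deg_le (iter j (fun z => Tvar * z + G * z ^+ 2 + z ^+ 4) z) (- k + j%:Z).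
Proof.
move=> hG; elim: j => [|j IH] le_bk le_jk hz; first by rewrite addr0.
have -> : - k + j.+1%:Z = - (k - j%:Z) + 1 by clear; lia.
apply: (phi_small hG); [by clear -le_bk; lia|by clear -le_jk; lia|].
have -> : - (k - j%:Z) = - k + j%:Z by clear; lia.
by apply: IH; [clear -le_bk; lia|clear -le_jk; lia|].
Qed.

Lemma deg_le_constF (c : 'F_2) : deg_le (c%:P : A)%:F 0.
Proof. by rewrite (deg_le_tofrac _ 0) /psize size_polyC_leq1. Qed.

Lemma act_small G z (k b : int) j (a : {poly 'F_2}) : deg_le G b -> b + j%:Z <= k -> j%:Z <= k ->
    (size a <= j.+1)%N -> deg_le z (- k) ->
  deg_le (poly_act (@FracField.tofrac {poly 'F_2})
            (fun z => Tvar * z + G * z ^+ 2 + z ^+ 4) a z) (- k + j%:Z).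
Proof.
move=> hG le_bk le_jk sa hz; apply: deg_le_sum => i _; rewrite -[X in deg_le _ X]add0r.
apply: deg_leM (deg_le_constF _) _.
have le_ij : (i <= j)%N by rewrite -ltnS (leq_trans (ltn_ord i)).
apply: deg_leW (iter_phi_small hG _ _ hz) _; clear -le_bk le_jk le_ij; lia.
Qed.

(** The size bounds control how far [e] and [f] raise degrees; the relation is an exact equality
    because nonzero scalars are 1. *)
Lemma bezout_F2 (a : {poly 'F_2}) : a != 0 -> (size a <= d)%N ->
  exists e f, [/\ e * a + f * p = 1, (size e <= d.+1)%N & (size f <= d.+1)%N].
Proof.
move=> a0 sa; have p0 : p != 0 by rewrite -size_poly_gt0 p_size.
have cop : coprimep a p.
  rewrite coprimep_sym; apply: irreducible_coprime => //; apply/negP => /(dvdp_leq a0).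
  by rewrite p_size ltnNge sa.
case: (egcdpP a0 p0); set e := (egcdp a p) => se1 se2 eq_e.
exists e.1, e.2; split; last 2 first.
- by rewrite -p_size.
- by apply: leq_trans se2 _; apply: leq_trans sa _.
have: e.1 * a + e.2 * p %= 1.
  by rewrite -(eqp_ltrans eq_e) -size_poly_eq1 -/(coprimep a p).
move/eqpP => [[c1 c2] /= /andP[c10 c20]].
by rewrite (F2_neq0 c10) (F2_neq0 c20) !scale1r.
Qed.

(** * Counting approximate roots by degree *)

Section Counting.
Variables (y : F) (K : int).
Hypothesis K_pos : 0 <= K.
(** Vectors code the polynomials of degree below d, so the approximate roots are indexed by a finite
    type of cardinal 2^d. *)
Let zv (v : 'rV['F_2]_d) := act (rVpoly v) y.
Hypothesis zv_tiny : forall v, deg_le (ueval (zv v)) (- K).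
Hypothesis zv_big : forall v, v != 0 -> ~~ deg_le (zv v) (- K).
Let ball s := [set v | deg_le (zv v) s].

Lemma zvD v w : zv (v + w) = zv v + zv w.
Proof. by rewrite /zv raddfD /act poly_actD. Qed.

Definition argmax s j := exists2 h, deg_eq (u j) h &
  forall i hi, deg_eq (u i) hi -> hi + pow2 i * s <= h + pow2 j * s.

Lemma argmax_le_d s j : argmax s j -> (j <= d)%N.
Proof.
case=> h hj _; rewrite leqNgt; apply/negP => /u_gt uj0.
by have := deg_eq_neq0 hj; rewrite uj0 eqxx.
Qed.

Lemma pow2_lt i j : (i < j)%N -> pow2 i < pow2 j.
Proof. by move=> lt_ij; rewrite /pow2 ltz_nat ltn_exp2l. Qed.

(* The number of approximate roots of degree at most [s] is at most the slope of the
   Newton polygon at [s]. *)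
Lemma card_ball (t : nat) : exists2 j, argmax (t%:Z - K) j & (#|ball (t%:Z - K)| <= 2 ^ j)%N.
Proof.
elim: t => [|t [j0 [h0 hj0 max0] card0]].
  have [I [h [le_Id hI maxI]]] := u_argmax (0 - K).
  exists I; first by exists h => // i hi /maxI[].
  apply: (@leq_trans 1%N); last by rewrite expn_gt0.
  apply: (@leq_trans #|[set (0 : 'rV['F_2]_d)]|); last by rewrite cards1.
  apply: subset_leq_card; apply/fintype.subsetP => v.
  by rewrite !inE sub0r; apply: contraTT => /zv_big.
have -> : t.+1%:Z - K = t%:Z - K + 1 by clear; lia.
set s := t%:Z - K in max0 card0 *.
have [j [h [le_jd hj maxj]]] := u_argmax (s + 1).
exists j; first by exists h => // i hi /maxj[].
(* When s grows by 1, an index i < j0 falls behind j0 by 2^j0 - 2^i. *)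
have lower i hi : (i < j0)%N -> deg_eq (u i) hi ->
    hi + pow2 i * (s + 1) < h0 + pow2 j0 * (s + 1).
  by move=> /pow2_lt lt_p /max0; clear -lt_p; lia.
have le_j0j : (j0 <= j)%N.
  rewrite leqNgt; apply/negP => lt_jj0; have := lower _ _ lt_jj0 hj.
  by have [le_ _] := maxj _ _ hj0; move: le_; clear; lia.
have [no|/negPn/existsP [w hw]] := boolP (~~ [exists w, deg_eq (zv w) (s + 1)]).
  apply: leq_trans (leq_trans card0 _); last by rewrite leq_exp2l.
  apply: subset_leq_card; apply/fintype.subsetP => v; rewrite !inE => le_v.
  apply: contraT => nle; case/negP: no; apply/existsP; exists v.
  by rewrite /deg_eq le_v addrK.
(* If j0 = j, this index is the only maximal one at s + 1: smaller ones lose by [lower], larger ones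
   by the choice of j. Then [ueval (zv w)] has degree at least s + 1 > -K, against [zv_tiny]. *)
have lt_j0j : (j0 < j)%N.
  rewrite ltn_neqAle le_j0j andbT; apply/eqP => eq_j.
  have eq_h : h0 = h by apply: deg_eq_inj hj0 _; rewrite eq_j.
  have: deg_eq (ueval (zv w)) (h + pow2 j * (s + 1)).
    rewrite /ueval (bigD1 (Ordinal (le_jd : (j < d.+1)%N))) //=.
    apply: deg_eqDlt (_ : deg_le _ (h + pow2 j * (s + 1) - 1)) _; last by clear; lia.
      by rewrite [pow2 j * _]mulrC; apply: deg_eqM hj (deg_eq_frob j hw).
    apply: deg_le_sum => i ne_ij.
    have [->|/deg_eqP [hi hhi]] := eqVneq (u i) 0; first by rewrite mul0r deg_le0.
    apply: deg_leW (deg_leM (deg_eq_le hhi) (deg_le_frob i (deg_eq_le hw))) _.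
    have : hi + pow2 i * (s + 1) < h + pow2 j * (s + 1).
      case: (ltngtP i j) => [lt_ij|lt_ji|eq_ij].
      - by have := lower _ _ _ hhi; rewrite eq_j eq_h; apply.
      - by have [_] := maxj _ _ hhi; apply.
      by case/eqP: ne_ij; apply: val_inj.
    by clear; lia.
  move/deg_eq_nle => /(_ _ (zv_tiny w)).
  have := maxj 0%N 0; rewrite u_0 pow2_0 => /(_ deg_eq1)[+ _].
  by rewrite /s; clear; lia.
apply: (@leq_trans (2 ^ j0.+1)); last by rewrite leq_exp2l.
rewrite expnS mul2n -addnn.
(* Adding w to an element of degree exactly s + 1 cancels the leading terms, so the ball at most
   doubles. *)
have sub : ball (s + 1) \subset ball s :|: [set w + v | v in ball s].
  apply/fintype.subsetP => v; rewrite inE finset.in_setU => le_v.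
  have [//|/=] := boolP (v \in ball s); rewrite inE => nle; apply/finset.imsetP.
  exists (w + v); last by rewrite addrA -mulr2n -scaler_nat pchar_Fp_0 // scale0r add0r.
  rewrite inE zvD; have -> : s = s + 1 - 1 by clear; lia.
  by apply: deg_eqDD => //; rewrite /deg_eq le_v addrK.
apply: leq_trans (subset_leq_card sub) _.
apply: leq_trans (leq_card_setU _ _) _; apply: leq_add => //.
exact: leq_trans (leq_imset_card _ _) card0.
Qed.

(** The ball of radius 0 then holds all 2^d vectors, which forces j = d: the Gauss norm at 0 is the
    degree of u_d = 1. *)
Lemma u_deg_le0 : (forall v, deg_le (zv v) 0) -> forall i, deg_le (u i) 0.
Proof.
move=> le0; have [j maxj] := card_ball `|K|.
have -> : `|K|%N%:Z - K = 0 by clear -K_pos; lia.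
have -> : ball 0 = [set: 'rV['F_2]_d] by apply/finset.setP => v; rewrite !inE le0.
rewrite cardsT card_mx card_Fp // mul1n leq_exp2l // => le_dj.
have le_jd := argmax_le_d maxj; have Ej : j = d by apply/eqP; rewrite eqn_leq le_jd.
move: maxj; have -> : `|K|%N%:Z - K = 0 by clear -K_pos; lia.
rewrite Ej => -[h]; rewrite u_d => /(deg_eq_inj deg_eq1) <- maxd i.
by apply: deg_le_neq0 => hi /maxd; rewrite !mulr0 !addr0.
Qed.
End Counting.

(** All u_i are now 0 or 1, and h = 0. The coefficient of tau^2 reads u_2 (T^4 + T) = g^2 + g', of
    degree at most 2, so u_2 = 0; all later coefficients follow, against u_d = 1. *)
Lemma u_const_absurd h : deg_eq g' (h%:Z + 2) -> deg_le g (h%:Z + 1) ->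
  deg_eq (u 1%N) h%:Z -> (forall i, deg_le (u i) 0) -> False.
Proof.
move=> hg' hg hu1 le0.
have h0 : h%:Z = 0 by have := deg_eq_nle hu1 (le0 1%N); clear; lia.
rewrite h0 add0r in hg' hg hu1.
have u01 i : u i = 0 \/ u i = 1.
  have [a def_a] := u_int i; have := le0 i; rewrite def_a (deg_le_tofrac _ 0).
  move=> /size1_polyC ->; case: (F2_cases a`_0) => ->; first by left; rewrite polyC0 tofrac0.
  by right; rewrite polyC1 tofrac1.
have u1 : u 1%N = 1.
  by case: (u01 1%N) => // u10; have := deg_eq_neq0 hu1; rewrite u10 eqxx.
have Ek k : u k.+2 * (Tvar ^+ (2 ^ k.+2) + Tvar) =
      u k.+1 * g ^+ (2 ^ k.+1) + u k + g' * u k.+1 ^+ 2 + u k ^+ 4.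
  have /addF_move/addF_move := isog_rec k.+1; rewrite mulrDr /= => ->.
  by rewrite [Tvar * _]mulrC addrC !addrA addFF add0r; ring.
have fix4 i : u i ^+ 4 = u i by case: (u01 i) => ->; rewrite ?expr1n ?expr0n.
have u2 : u 2%N = 0.
  case: (u01 2%N) => // u2; exfalso.
  have T4 := deg_eqX 4 deg_eq_Tvar.
  have := Ek 0%N; rewrite u2 u1 u_0 !mul1r expr1n mulr1 expr1n -addrA addrACA addFF addr0 => E.
  have d4 : deg_eq (Tvar ^+ (2 ^ 2) + Tvar) 4.
    by apply: (deg_eqDlt (m := 1)) => //; apply: deg_eq_le deg_eq_Tvar.
  have le2 : deg_le (Tvar ^+ (2 ^ 2) + Tvar) 2.
    rewrite E; apply: deg_leD; last exact: deg_eq_le.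
    by apply: deg_leW (deg_le_sq hg) _.
  by have := deg_eq_nle d4 le2.
have u_ge2 k : u k.+2 = 0.
  elim: k => [//|k IH].
  have := Ek k.+1; rewrite IH fix4 expr0n /= mul0r mulr0 add0r addr0 addFF => /eqP.
  rewrite mulf_eq0 => /orP[/eqP //|/eqP E]; exfalso.
  have T4 := deg_eq_frob k.+3 deg_eq_Tvar.
  have: deg_eq (Tvar ^+ (2 ^ k.+3) + Tvar) (pow2 k.+3).
    rewrite mul1r in T4; apply: deg_eqDlt T4 (deg_eq_le deg_eq_Tvar) _.
    by rewrite !pow2S; have := pow2_gt0 k; clear; lia.
  by move/deg_eq_neq0; rewrite E eqxx.
have /eqP := u_d; case: d d_gt1 => [|[|d']] // _.
by rewrite u_ge2 eq_sym oner_eq0.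
Qed.

Theorem no_etale_isogeny : False.
Proof.
have [h [hg' hg hu1 hu]] := u1_deg.
have h_ge0 : 0 <= h%:Z by [].
have [M [M1 leM gM le_Mh]] : exists M, [/\ 1 <= M, deg_le g M,
    M = 1 \/ deg_eq g M & M <= h%:Z + 1].
  have [le1|/deg_leNP [m hm lt_m]] := boolP (deg_le g 1).
    by exists 1; split=> //; [left|clear; lia].
  exists m; split; [by clear -lt_m; lia|exact: deg_eq_le|by right|].
  exact: deg_eq_nle hm hg.
have [B hB] := ueval_bounded.
(* N adds to the d iterates of interest the B + |M| steps that refute an escape. K leaves room for a
   Bezout factor, since -K + d < -h. With k, the error stays tiny through N iterates, and under [V]
   followed by a factor of degree at most d. *)
pose N := (d + B + `|M|)%N.
pose K : int := h%:Z + d%:Z + 2.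
pose k := (N + Cv + 2 * d + h + 4)%N.
have [y [hy le_uy]] := approx_root hu1 hu k.
pose L : int := h%:Z + 1 + k%:Z.
have le_uyL : deg_le (ueval y) (- L) by apply: deg_leW le_uy _; rewrite /L; clear; lia.
have le_iter n : (n <= N)%N -> deg_le (ueval (iter n phi y)) (- L + n%:Z).
  move=> le_nN; have -> : ueval (iter n phi y) = iter n phi' (ueval y).
    by elim: n {le_nN} => //= n <-; rewrite ueval_phi.
  by apply: (iter_phi_small (deg_eq_le hg')); rewrite ?le_uyL // /L /k; clear -le_nN; lia.
have stay n : (n <= d)%N -> deg_le (iter n phi y) (1 - M).
  apply: (iterates_stay M1 leM gM (B := B)).
    by apply: deg_leW (deg_eq_le hy) _; clear -le_Mh; lia.
  move=> j le_jN; apply: hB; apply: deg_leW (le_iter j le_jN) _.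
  by rewrite /L /k; clear -le_jN; lia.
have K0 : 0 <= K by rewrite /K; clear; lia.
have sv (v : 'rV['F_2]_d) : (size (rVpoly v) <= d)%N by apply: size_poly.
apply: (@u_const_absurd h) => //.
apply: (@u_deg_le0 y K) => // v.
- rewrite ueval_act; apply: deg_leW (act_small (j := d) (deg_eq_le hg') _ _ _ le_uyL) _.
  + by rewrite /L /k; clear; lia.
  + by rewrite /L /k; clear; lia.
  + exact: leqW.
  by rewrite /K /L /k; clear; lia.
- move=> v0; apply/negP => le_z.
  have a0 : rVpoly v != 0 by apply: contra_neq v0 => v0; rewrite -[v]rVpolyK v0 raddf0.
  have [e [f [Eef se sf]]] := bezout_F2 a0 (sv v).
  (* If the multiple of y by a nonzero polynomial were tiny, so would be y, whose degree is -h. *)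
  have Ey : y = act e (act (rVpoly v) y) + act f (V (ueval y)).
    by rewrite -V_ueval /act -!poly_actM -?poly_actD ?Eef ?poly_act1 //; apply: phi_add.
  have: deg_le y (- h%:Z - 1).
    rewrite Ey; apply: deg_leD.
      apply: deg_leW (act_small (j := d) hg _ _ se le_z) _; rewrite /K; clear; lia.
    have le_V : deg_le (V (ueval y)) (- (L - Cv%:Z)).
      have -> : - (L - Cv%:Z) = - L + Cv%:Z by clear; lia.
      by apply: V_bound => //; rewrite /L; clear; lia.
    by apply: deg_leW (act_small (j := d) hg _ _ sf le_V) _; rewrite /L /k; clear; lia.
  by move/(deg_eq_nle hy); clear; lia.
apply: deg_le_sum => i _; rewrite -[X in deg_le _ X]add0r; apply: deg_leM (deg_le_constF _) _.
apply: deg_leW (stay i _) _; last by clear -M1; lia.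
exact: ltnW (leq_trans (ltn_ord i) (sv v)).
Qed.

End ArithmeticCore.

(** * Drinfeld modules as skew polynomials *)

(** The inner ['X], under [%:P], is T; the outer one is tau. *)
Definition drinfeld_T (G : {poly 'F_2}) : {poly {poly 'F_2}} :=
  'X%:P + G%:P * 'X + 'X^2.

Definition drinfeld_poly (G a : {poly 'F_2}) : {poly {poly 'F_2}} :=
  \sum_(i < size a) (a`_i)%:P *: iter i (skew_mul (drinfeld_T G)) 1.

Lemma drinfeld_T_coef G i : (drinfeld_T G)`_i =
  if i is i1.+1 then if i1 is i2.+1 then (i2 == 0%N)%:R else G else 'X.
Proof.
rewrite /drinfeld_T !coefD coefC coefCM coefX coefXn.
by case: i => [|[|[|i]]] /=; rewrite ?mulr0 ?mulr1 ?addr0 ?add0r.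
Qed.

Lemma drinfeld_T_monic G : skew_monic 2 (drinfeld_T G).
Proof.
apply: skew_monicI; last by rewrite drinfeld_T_coef.
by apply/leq_sizeP => -[|[|[|j]]] // _; rewrite drinfeld_T_coef.
Qed.

Lemma drinfeld_iter_monic G i : skew_monic (2 * i) (iter i (skew_mul (drinfeld_T G)) 1).
Proof.
elim: i => [|i IH]; first by rewrite /skew_monic size_poly1 coef1 !eqxx.
by rewrite mulnS; exact: (skew_monic_mul (drinfeld_T_monic G) IH).
Qed.

Lemma coef0_skew_mul (R : comNzRingType) (f g : {poly R}) :
  (skew_mul f g)`_0 = f`_0 * g`_0.
Proof. by rewrite coef_skew_mul big_ord1. Qed.

Lemma drinfeld_poly_coef0 G a : (drinfeld_poly G a)`_0 = a.
Proof.
rewrite coef_sum -[RHS]coefK poly_def; apply: eq_bigr => i _; rewrite coefZ -mul_polyC.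
congr (_ * _); elim: (i : nat) => [|j IH] /=; first by rewrite coef1 expr0.
by rewrite coef0_skew_mul IH drinfeld_T_coef exprS.
Qed.

Lemma drinfeld_poly_monic G a n : a \is monic -> size a = n.+1 ->
  skew_monic (2 * n) (drinfeld_poly G a).
Proof.
move=> a_monic sa; have an : a`_n = 1.
  by move/monicP: a_monic; rewrite /lead_coef sa.
rewrite /drinfeld_poly sa big_ord_recr /= an polyC1 scale1r.
have lt i : (i < n)%N -> (size (iter i (skew_mul (drinfeld_T G)) 1%R) <= 2 * n)%N.
  by move=> lt_in; rewrite (skew_monic_size (drinfeld_iter_monic G i)); lia.
have le_sum : (size (\sum_(i < n) (a`_i)%:P *: iter i (skew_mul (drinfeld_T G)) 1)%R
    <= 2 * n)%N.
  apply: leq_trans (size_sum _ _ _) _; apply/bigmax_leqP => i _.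
  by apply: leq_trans (size_scale_leq _ _) _; apply: lt.
have mon := drinfeld_iter_monic G n.
apply: skew_monicI; last by rewrite coefD nth_default // add0r (skew_monic_lead mon).
apply: leq_trans (size_polyD _ _) _; rewrite geq_max (skew_monic_size mon) leqnn andbT.
exact: leqW.
Qed.

Section Evaluation.
Variables (R : comNzRingType) (char2 : 2%N \in [pchar R]).
Variable rho : {rmorphism {poly 'F_2} -> R}.

Definition drinfeld_map (G : {poly 'F_2}) (z : R) :=
  rho 'X * z + rho G * z ^+ 2 + z ^+ 4.

Lemma drinfeld_mapE G z : skew_eval (map_poly rho (drinfeld_T G)) z = drinfeld_map G z.
Proof.
rewrite (@skew_evalE _ 3); last first.
  by apply: leq_trans (size_poly _ _) _; rewrite (skew_monic_size (drinfeld_T_monic G)).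
by rewrite !big_ord_recl big_ord0 !coef_map !drinfeld_T_coef /= rmorph1 addr0 mul1r expr1 addrA.
Qed.

Lemma drinfeld_polyE G a z :
  skew_eval (map_poly rho (drinfeld_poly G a)) z = poly_act rho (drinfeld_map G) a z.
Proof.
rewrite /drinfeld_poly rmorph_sum skew_eval_sum; apply: eq_bigr => i _.
rewrite /= map_polyZ skew_evalZ; congr (_ * _); elim: (i : nat) => [|j IH] /=.
  by rewrite rmorph1 -polyC1 skew_evalC mul1r.
by rewrite map_skew_mul skew_eval_mul // drinfeld_mapE IH.
Qed.

Lemma drinfeld_map_add G x y : drinfeld_map G (x + y) = drinfeld_map G x + drinfeld_map G y.
Proof. by rewrite -!drinfeld_mapE skew_eval_add. Qed.
End Evaluation.

Lemma skew_rec_of_eq (u : {poly {poly 'F_2}}) (G G' : {poly 'F_2}) :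
    skew_mul u (drinfeld_T G) = skew_mul (drinfeld_T G') u ->
  forall k, u`_k.+1 * 'X ^+ (2 ^ k.+1) + u`_k * G ^+ (2 ^ k) + (if k is k'.+1 then u`_k' else 0) =
    'X * u`_k.+1 + G' * u`_k ^+ 2 + (if k is k'.+1 then u`_k' else 0) ^+ 4.
Proof.
move=> E k; transitivity (skew_mul u (drinfeld_T G))`_k.+1.
  case: k => [|k].
    by rewrite coef_skew_mul !big_ord_recr big_ord0 /= add0r !drinfeld_T_coef addr0 addrC.
  rewrite coef_skew_mul 3!big_ord_recr /= !drinfeld_T_coef.
  have -> : (k.+2 - k = 2)%N by lia.
  have -> : (k.+2 - k.+1 = 1)%N by lia.
  rewrite subnn big1 => [|i _]; last first.
    have -> : (k.+2 - i = (k - i.+1).+3)%N by have := ltn_ord i; lia.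
    by rewrite drinfeld_T_coef expr0n expn_eq0 mulr0.
  by rewrite /= expr1n mulr1 add0r [RHS]addrC [X in _ = _ + X]addrC addrA.
rewrite E (coef_skew_mul_widen u k.+1 (eq_leq (skew_monic_size (drinfeld_T_monic G')))).
rewrite !big_ord_recl big_ord0 !drinfeld_T_coef /= /bump /= subn0 !subSS subn0 !addr0 mul1r addrA.
by rewrite expr1; case: k => [|k] //=; rewrite ?expr0n // subSS subn0.
Qed.

Lemma etale_case (p : {poly 'F_2}) d (u v : {poly {poly 'F_2}}) (G G' : {poly 'F_2}) :
    irreducible_poly p -> size p = d.+1 -> (1 < d)%N ->
    skew_monic d u -> u`_0 = 1 ->
    skew_mul u (drinfeld_T G) = skew_mul (drinfeld_T G') u ->
    skew_mul v u = drinfeld_poly G p -> False.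
Proof.
move=> p_irr sp d1 mu u0 E Ev.
pose tf : {rmorphism {poly 'F_2} -> F} := @FracField.tofrac {poly 'F_2}.
have uevalE y : ueval d (fun i => tf u`_i) y = skew_eval (map_poly tf u) y.
  rewrite (@skew_evalE _ d.+1); last first.
    by apply: leq_trans (size_poly _ _) _; rewrite (skew_monic_size mu).
  by apply: eq_bigr => i _; rewrite coef_map.
have [Cv hCv] : exists Cv : nat, forall i, deg_le (tf v`_i) Cv%:Z.
  exists (\max_(i < size v) psize (v`_i)%R) => i; rewrite deg_le_tofrac; apply: leqW.
  case: (ltnP i (size v)) => [lt_i|le_i]; last by rewrite nth_default // /psize size_poly0.
  exact: (leq_bigmax (Ordinal lt_i)).
apply: (@no_etale_isogeny d (fun i => tf u`_i) (tf G) (tf G') d1 _ _ _ _ _ _ p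
         (skew_eval (map_poly tf v)) Cv p_irr sp).
- by rewrite u0 rmorph1.
- by rewrite (skew_monic_lead mu) rmorph1.
- by move=> i lt_di; rewrite nth_default ?rmorph0 // (skew_monic_size mu).
- by move=> i; exists u`_i.
- move=> k; have /(congr1 tf) := skew_rec_of_eq E k.
  rewrite !rmorphD !rmorphM !rmorphXn /=; congr (_ + _ + _ = _ + _ + _).
  - by case: k => [|k]; rewrite /= ?rmorph0.
  by case: k => [|k]; rewrite /= ?rmorph0.
- move=> y; rewrite !uevalE -[phi _ y](drinfeld_mapE tf G) -[phi' _ _](drinfeld_mapE tf G').
  by rewrite -!(skew_eval_mul pcharF) -!map_skew_mul E.
- move=> z n n0 hz; apply: deg_le_sum => i _; rewrite coef_map addrC.
  apply: deg_leM (hCv i) _; apply: deg_leW (deg_le_frob i hz) _.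
  by have := pow2_gt0 i; clear -n0; nia.
by move=> y; rewrite uevalE -(skew_eval_mul pcharF) -map_skew_mul Ev (drinfeld_polyE pcharF).
Qed.

(** Powers of T provide enough test points. Identities in A{tau}, associativity included, thereby
    reduce to identities between maps. *)
Lemma skew_eval_inj (f f' : {poly {poly 'F_2}}) :
  (forall x, skew_eval f x = skew_eval f' x) -> f = f'.
Proof.
move=> ff'; apply/eqP; rewrite -subr_eq0; apply/eqP.
set q := f - f'; have q0 x : skew_eval q x = 0.
  by rewrite skew_evalD -scaleN1r skew_evalZ mulN1r ff' subrr.
pose s := [seq 'X^i | i <- iota 0 (2 ^ size q)] : seq {poly 'F_2}.
apply: (@skew_eval_zeros _ q s (size q)) => //; last by rewrite size_map size_iota.
rewrite map_inj_uniq ?iota_uniq // => i j /(congr1 (fun w : {poly 'F_2} => size w)).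
by rewrite !size_polyXn => -[].
Qed.

Lemma skew_mulA (f g h : {poly {poly 'F_2}}) :
  skew_mul f (skew_mul g h) = skew_mul (skew_mul f g) h.
Proof. by apply: skew_eval_inj => x; rewrite !(skew_eval_mul pcharA). Qed.

Lemma skew_mul_inj (f f' u : {poly {poly 'F_2}}) n :
  skew_monic n u -> skew_mul f u = skew_mul f' u -> f = f'.
Proof.
move=> mu E; apply/eqP; rewrite -subr_eq0; apply/eqP; apply: (skew_mul_cancel mu).
by apply: (addIr (skew_mul f' u)); rewrite -skew_mulDl subrK add0r.
Qed.

Lemma drinfeld_polyE_id G a z :
  skew_eval (drinfeld_poly G a) z = poly_act idfun (drinfeld_map idfun G) a z.
Proof. by rewrite -(drinfeld_polyE pcharA) map_poly_id. Qed.

Lemma drinfeld_mapE_id G z : skew_eval (drinfeld_T G) z = drinfeld_map idfun G z.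
Proof. by rewrite -drinfeld_mapE map_poly_id. Qed.

Lemma drinfeld_poly_comm G a :
  skew_mul (drinfeld_poly G a) (drinfeld_T G) = skew_mul (drinfeld_T G) (drinfeld_poly G a).
Proof.
apply: skew_eval_inj => x; rewrite !(skew_eval_mul pcharA) !drinfeld_polyE_id !drinfeld_mapE_id.
have addm := @drinfeld_map_add _ pcharA idfun G.
by rewrite -(poly_actX idfun addm) -[in RHS](poly_actX idfun addm) -!poly_actM // mulrC.
Qed.

Lemma drinfeld_poly_intertwine (u : {poly {poly 'F_2}}) G G' a :
    skew_mul u (drinfeld_T G) = skew_mul (drinfeld_T G') u ->
  skew_mul u (drinfeld_poly G a) = skew_mul (drinfeld_poly G' a) u.
Proof.
move=> E; apply: skew_eval_inj => x; rewrite !(skew_eval_mul pcharA) !drinfeld_polyE_id.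
apply: poly_act_intertwine => [y z|y]; first exact: (skew_eval_add pcharA).
by rewrite -!drinfeld_mapE_id -!(skew_eval_mul pcharA) E.
Qed.

Lemma no_isogeny (p : {poly 'F_2}) d (u v : {poly {poly 'F_2}}) (G G' : {poly 'F_2}) :
    irreducible_poly p -> size p = d.+1 -> (1 < d)%N ->
    skew_monic d u -> skew_monic d v ->
    skew_mul u (drinfeld_T G) = skew_mul (drinfeld_T G') u ->
    skew_mul v u = drinfeld_poly G p -> False.
Proof.
move=> p_irr sp d1 mu mv E Ev.
have p0 : p != 0 by rewrite -size_poly_gt0 sp.
have vu0 : v`_0 * u`_0 = p by rewrite -coef0_skew_mul Ev drinfeld_poly_coef0.
have [su|su] := eqVneq (size u`_0) 1%N.
  exact: (etale_case p_irr sp d1 mu (size1_F2 su) E Ev).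
have /eqp_size su0 : u`_0 %= p.
  by case: p_irr => _; apply => //; rewrite -vu0 dvdp_mull.
have v00 : v`_0 != 0 by apply: contra_neq p0 => v0; rewrite -vu0 v0 mul0r.
have u00 : u`_0 != 0 by rewrite -size_poly_gt0 su0 sp.
have sv : size v`_0 = 1%N.
  have := congr1 psize vu0; rewrite (psize_mul v00 u00).
  have -> : psize u`_0 = d.+1 := etrans su0 sp.
  have -> : psize p = d.+1 := sp.
  by have := psize_gt0 v00; rewrite -/(psize v`_0); clear; lia.
(* v phi'_T u = v u phi_T = phi_p phi_T = phi_T phi_p = phi_T v u, and the monic u cancels on the
   right. *)
have E' : skew_mul v (drinfeld_T G') = skew_mul (drinfeld_T G) v.
  apply: (skew_mul_inj mu); rewrite -!skew_mulA -E skew_mulA Ev.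
  by rewrite drinfeld_poly_comm.
apply: (etale_case p_irr sp d1 mv (size1_F2 sv) E') (_ : skew_mul u v = _).
(* Likewise u v u = u phi_p = phi'_p u. *)
apply: (skew_mul_inj mu); rewrite -skew_mulA Ev.
exact: drinfeld_poly_intertwine.
Qed.

(** * The fixed field of the automorphisms of a separable closure *)

Section MkRmorphism.
Variables (L : fieldType) (s : L -> L).
Hypotheses (s_sub : zmod_morphism s) (s_mul : monoid_morphism s).
HB.instance Definition _ := GRing.isZmodMorphism.Build L L s s_sub.
HB.instance Definition _ := GRing.isMonoidMorphism.Build L L s s_mul.
Definition mk_rmorphism : {rmorphism L -> L} := s.
End MkRmorphism.

Section GaloisFixed.
Variables (E L : fieldType) (iota : {rmorphism E -> L}).
Hypothesis sep_alg : forall x : L, exists p : {poly E},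
  p != 0 /\ separable_poly p /\ root (map_poly iota p) x.
Hypothesis sep_closed : forall p : {poly L},
  (1 < size p)%N -> separable_poly p -> exists x, root p x.

Local Notation LL := (L * L)%type.

Definition diag (e : E) : LL := (iota e, iota e).

Lemma diag_sub : zmod_morphism diag.
Proof. by move=> a b; rewrite /diag !rmorphB. Qed.

Lemma diag_mul : monoid_morphism diag.
Proof. by split=> [|a b]; rewrite /diag ?rmorph1 ?rmorphM. Qed.

HB.instance Definition _ := GRing.isZmodMorphism.Build E LL diag diag_sub.
HB.instance Definition _ := GRing.isMonoidMorphism.Build E LL diag diag_mul.

Lemma map_fst_diag (p : {poly E}) : map_poly fst (map_poly diag p) = map_poly iota p.
Proof. by apply/polyP => i; rewrite !coef_map. Qed.

Lemma map_snd_diag (p : {poly E}) : map_poly snd (map_poly diag p) = map_poly iota p.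
Proof. by apply/polyP => i; rewrite !coef_map. Qed.

(* Graphs of partial automorphisms of L over E, as subrings of L x L. *)
Definition partial_iso (G : set LL) :=
  [/\ forall e, G (diag e), forall a b, G a -> G b -> G (a - b),
      forall a b, G a -> G b -> G (a * b) & forall y, G (0, y) -> y = 0].

Section PartialIso.
Variables (G : set LL) (isoG : partial_iso G).

Let GE e : G (diag e). Proof. by case: isoG. Qed.
Let GB a b : G a -> G b -> G (a - b). Proof. by case: isoG => _ + _ _; apply. Qed.
Let GM a b : G a -> G b -> G (a * b). Proof. by case: isoG => _ _ + _; apply. Qed.
Let Gf y : G (0, y) -> y = 0. Proof. by case: isoG => _ _ _; apply. Qed.

Let G0 : G 0. Proof. by rewrite -(rmorph0 diag). Qed.
Let G1 : G 1. Proof. by rewrite -(rmorph1 diag). Qed.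
Let GN a : G a -> G (- a). Proof. by rewrite -sub0r; apply: GB. Qed.
Let GD a b : G a -> G b -> G (a + b).
Proof. by move=> Ga Gb; rewrite -[b]opprK; apply: GB => //; apply: GN. Qed.

Lemma partial_iso_eq0 a : G a -> a.1 = 0 -> a = 0.
Proof. by case: a => a b Gab /= a0; move: Gab; rewrite a0 => /Gf ->. Qed.

Let G_horner (q : {poly E}) a : G a -> G (map_poly diag q).[a].
Proof.
move=> Ga; elim/poly_ind: q => [|q c IH]; first by rewrite rmorph0 horner0.
rewrite rmorphD rmorphM /= map_polyX map_polyC hornerD hornerMX hornerC.
by apply: GD => //; apply: GM.
Qed.

(** Strip factors X from a polynomial killing [a.1] until its constant term c is nonzero; the
    remaining relation q(a) a = -c gives the inverse. *)
Lemma partial_iso_inv a : G a -> a.1 != 0 -> exists2 c, G c & c * a = 1.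
Proof.
move=> Ga a0; have [p [p0 [_ pa]]] := sep_alg a.1.
have {}pa : ((map_poly diag p).[a]).1 = 0.
  by rewrite -(horner_map fst) /= map_fst_diag; apply/rootP.
suff [c Gc ca] : exists2 c, G c & (c * a).1 = 1.
  exists c => //; apply/eqP; rewrite -subr_eq0; apply/eqP; apply: partial_iso_eq0.
    by apply: GB => //; apply: GM.
  by rewrite /= in ca *; rewrite ca subrr.
elim/poly_ind: p p0 pa => [|p c IH]; first by rewrite eqxx.
move=> pc0; rewrite rmorphD rmorphM /= map_polyX map_polyC hornerD hornerMX hornerC /=.
have [c0|c0] := eqVneq c 0.
  rewrite c0 rmorph0 addr0 => /eqP; rewrite mulf_eq0 (negPf a0) orbF => /eqP.
  by apply: IH; apply: contra_neq pc0 => ->; rewrite c0 mul0r add0r.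
move=> /eqP; rewrite addr_eq0 => /eqP pa.
exists (diag (- c^-1) * (map_poly diag p).[a]); first by apply: GM => //; apply: G_horner.
by rewrite /= -mulrA pa rmorphN mulrNN -rmorphM mulVf // rmorph1.
Qed.

Lemma partial_iso_inj x : G (x, 0) -> x = 0.
Proof.
move=> Gx; apply/eqP; apply: contraT => x0.
have [c _ /(congr1 snd) /= /eqP] := partial_iso_inv Gx x0.
by rewrite mulr0 eq_sym oner_eq0.
Qed.

Definition coefs_in (q : {poly LL}) := forall i, G q`_i.

Let GP_sub p q : coefs_in p -> coefs_in q -> coefs_in (p - q).
Proof. by move=> Gp Gq i; rewrite coefB; apply: GB. Qed.

Let GP_mul p q : coefs_in p -> coefs_in q -> coefs_in (p * q).
Proof.
move=> Gp Gq i; rewrite coefM; apply: (big_ind G) => // j _; exact: GM.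
Qed.

Let GP_C a : G a -> coefs_in a%:P.
Proof. by move=> Ga i; rewrite coefC; case: ifP. Qed.

Let GP_Xn n : coefs_in 'X^n.
Proof. by move=> i; rewrite coefXn; case: eqP. Qed.

Variable z : L.
Definition kills (q : {poly LL}) := (map_poly fst q).[z] = 0.

(** A polynomial over the graph pairs one over the source field with its transport to the target;
    [q] pairs the minimal polynomial of [z] with its conjugate. *)
Lemma min_poly_pair : exists q : {poly LL}, [/\ coefs_in q, q \is monic, kills q &
  forall r, coefs_in r -> kills r -> (size r < size q)%N -> r = 0].
Proof.
pose Q n := `[< exists q : {poly LL}, [/\ coefs_in q, q \is monic, kills q & size q = n] >].
have exQ : exists n, Q n.
  have [p [p0 [_ pz]]] := sep_alg z.
  pose p1 := (lead_coef p)^-1 *: p.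
  have p1m : p1 \is monic by rewrite monicE lead_coefZ mulVf ?lead_coef_eq0.
  exists (size (map_poly diag p1)); apply/asboolP; exists (map_poly diag p1); split=> //.
  - by move=> i; rewrite coef_map.
  - exact: monic_map.
  rewrite /kills map_fst_diag map_polyZ hornerZ.
  by rewrite (rootP pz) mulr0.
case: (ex_minnP exQ) => n /asboolP [q [Gq qm qz sq]] min_n; exists q; split=> // r Gr rz lt_rq.
apply/eqP; apply: contraT => r0.
have l0 : lead_coef r != 0 by rewrite lead_coef_eq0.
have Gl : G (lead_coef r) by apply: Gr.
have l10 : (lead_coef r).1 != 0 by apply: contra_neq l0 => /(partial_iso_eq0 Gl).
have [c Gc cl] := partial_iso_inv Gl l10.
have cr : (c *: r)`_(size r).-1 = 1 by rewrite coefZ.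
have sr : size (c *: r) = size r.
  apply/eqP; rewrite eqn_leq size_scale_leq /=.
  rewrite -[X in (X <= _)%N]prednK ?size_poly_gt0 // ltnNge.
  by apply: contra_eqN cr => /(nth_default 0) ->; rewrite eq_sym oner_neq0.
have : Q (size r).
  apply/asboolP; exists (c *: r); split=> //.
  - by move=> i; rewrite coefZ; apply: GM.
  - by rewrite monicE /lead_coef sr cr.
  by rewrite /kills map_polyZ hornerZ rz mulr0.
by move/min_n; rewrite -sq leqNgt lt_rq.
Qed.

Lemma min_poly_pair_dvd q r : coefs_in q -> q \is monic -> kills q ->
    (forall r, coefs_in r -> kills r -> (size r < size q)%N -> r = 0) ->
  coefs_in r -> kills r -> exists t, r = t * q.
Proof.
move=> Gq qm qz min_q; have [n] := ubnP (size r); elim: n r => // n IH r lt_rn Gr rz.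
case: (ltnP (size r) (size q)) => [lt_rq|le_qr].
  by exists 0; rewrite mul0r; apply: min_q.
have q_gt0 : (0 < size q)%N by rewrite size_poly_gt0 monic_neq0.
have r_gt0 : (0 < size r)%N by apply: leq_trans q_gt0 le_qr.
pose m := ((lead_coef r)%:P * 'X^(size r - size q)) : {poly LL}.
have Gm : coefs_in m by apply: GP_mul => //; apply/GP_C/Gr.
have smq : (size (m * q)%R <= size r)%N.
  apply: leq_trans (size_polyMleq _ _) _.
  have : (size m <= (size r - size q).+1)%N.
    by rewrite /m mul_polyC; apply: leq_trans (size_scale_leq _ _) _; rewrite size_polyXn.
  by move: q_gt0 le_qr; clear; lia.
have [|||t Et] := IH (r - m * q).
- rewrite -ltnS (leq_trans _ lt_rn) // ltnS.
  rewrite -[X in (_ < X)%N](prednK r_gt0) ltnS; apply/leq_sizeP => j.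
  rewrite leq_eqVlt => /predU1P[<-|lt_j].
    rewrite coefB /m -mulrA coefCM coefXnM.
    have -> : ((size r).-1 < size r - size q)%N = false.
      by apply/negbTE; move: q_gt0 le_qr; clear; lia.
    have -> : ((size r).-1 - (size r - size q) = (size q).-1)%N.
      by move: q_gt0 le_qr; clear; lia.
    by rewrite -[q`_ _]/(lead_coef q) (monicP qm) mulr1 subrr.
  have le_rj : (size r <= j)%N by rewrite -[X in (X <= _)%N](prednK r_gt0).
  by rewrite coefB !nth_default ?subrr // (leq_trans smq).
- by apply: GP_sub => //; apply: GP_mul.
- by rewrite /kills rmorphB rmorphM /= hornerD hornerN hornerM rz qz mulr0 subr0.
by exists (t + m); rewrite mulrDl -Et subrK.
Qed.

(** z may be sent to any root z' of the conjugate polynomial; the new graph consists of the values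
    r(z, z'). It is single-valued because an r killing z is a multiple of the minimal pair. Keeping
    [q0] shows that for the diagonal [q] has coefficients in E. *)
Lemma partial_iso_extend : exists q : {poly L}, [/\ (1 < size q)%N, separable_poly q &
  forall z', root q z' -> exists G', [/\ partial_iso G', subset G G' & G' (z, z')]] /\
  exists q0, [/\ coefs_in q0, q0 \is monic, kills q0 & q = map_poly snd q0].
Proof.
have [q [Gq qm qz min_q]] := min_poly_pair.
have dvd_q := min_poly_pair_dvd Gq qm qz min_q.
have sq : size (map_poly (snd : LL -> L) q) = size q.
  by rewrite size_map_poly_id0 // (monicP qm) /= oner_neq0.
exists (map_poly snd q); split; last by exists q.
split.
- rewrite sq ltnNge; apply/negP => le1.
  have q1 : q = 1.
    apply/eqP; rewrite -[q == 1]/(q == 1%:P) (size1_polyC le1); apply/eqP; congr (_%:P).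
    move/monicP: qm; rewrite /lead_coef; case: (size q) le1 => [|[|n]] //.
  by have /eqP := qz; rewrite q1 rmorph1 hornerC oner_eq0.
- have [p [p0 [p_sep pz]]] := sep_alg z.
  have [||t Et] := dvd_q (map_poly diag p).
  + by move=> i; rewrite coef_map.
  + by rewrite /kills map_fst_diag; apply/rootP.
  apply: (@dvdp_separable _ (map_poly iota p)); last by rewrite separable_map.
  by rewrite -map_snd_diag Et rmorphM dvdp_mull.
move=> z' /rootP qz'; pose e : LL := (z, z').
have qe : q.[e] = 0.
  rewrite [q.[e]]surjective_pairing -(horner_map fst) -(horner_map snd) /=.
  by rewrite qz' [_.[z]]qz.
pose G' (a : LL) := exists2 r, coefs_in r & r.[e] = a.
exists G'; split.
- split.
  + by move=> c; exists (diag c)%:P; [apply: GP_C|rewrite hornerC].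
  + move=> a b [r Gr <-] [s Gs <-]; exists (r - s); first exact: GP_sub.
    by rewrite hornerD hornerN.
  + by move=> a b [r Gr <-] [s Gs <-]; exists (r * s); [apply: GP_mul|rewrite hornerM].
  move=> y [r Gr re]; have [||t Et] := dvd_q r => //.
    by rewrite /kills -[z]/(fst e) horner_map re.
  by move: re; rewrite Et hornerM qe mulr0 => -[].
- by move=> a Ga; exists a%:P; [apply: GP_C|rewrite hornerC].
by exists 'X; [rewrite -['X]expr1; apply: GP_Xn|rewrite hornerX].
Qed.

End PartialIso.

Lemma partial_iso_diag : partial_iso (range diag).
Proof.
split.
- by move=> e; exists e.
- by move=> a b [x _ <-] [y _ <-]; exists (x - y) => //; rewrite rmorphB.
- by move=> a b [x _ <-] [y _ <-]; exists (x * y) => //; rewrite rmorphM.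
by move=> y [e _ [/eqP]]; rewrite fmorph_eq0 => /eqP -> <-; rewrite rmorph0.
Qed.

Definition transpose (G : set LL) : set LL := fun a => G (a.2, a.1).

Lemma partial_iso_transpose G : partial_iso G -> partial_iso (transpose G).
Proof.
move=> isoG; case: (isoG) => GE GB GM Gf; split.
- by move=> e; apply: GE.
- by move=> [a1 a2] [b1 b2]; apply: GB.
- by move=> [a1 a2] [b1 b2]; apply: GM.
by move=> y; apply: partial_iso_inj.
Qed.

Lemma partial_iso_extend_at G z : partial_iso G ->
  exists G' z', [/\ partial_iso G', subset G G' & G' (z, z')].
Proof.
move=> isoG; have [q [[sq qs ext] _]] := partial_iso_extend isoG z.
by have [z' /ext [G' hG']] := sep_closed sq qs; exists G', z'.
Qed.

Lemma partial_iso_total G0 : partial_iso G0 -> exists s : {rmorphism L -> L},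
  [/\ bijective s, forall e, s (iota e) = iota e & forall a, G0 a -> s a.1 = a.2].
Proof.
move=> iso0.
pose P (X : set LL) := X = set0 \/ (partial_iso X /\ subset G0 X).
have [FF FP Ftot|G [PG maxG]] := @Zorn_bigcup _ P.
  have [[X0 [FX0 PX0]]|no] := pselect (exists X, FF X /\ (partial_iso X /\ subset G0 X)).
    right; split; last by move=> a /(PX0.2) Xa; exists X0.
    have two a b : (\bigcup_(X in FF) X)%classic a -> (\bigcup_(X in FF) X)%classic b ->
        exists X, [/\ FF X, partial_iso X, X a & X b].
      move=> [X FX Xa] [Y FY Yb].
      have isoX Z c : FF Z -> Z c -> partial_iso Z.
        by move=> FZ Zc; case: (FP _ FZ) => [Z0|[]//]; move: Zc; rewrite Z0.
      case: (Ftot _ _ FX FY) => sub.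
        by exists Y; split=> //; [apply: isoX Yb|apply: sub].
      by exists X; split=> //; [apply: isoX Xa|apply: sub].
    split.
    - by move=> e; exists X0 => //; case: PX0 => -[].
    - by move=> a b /two h /h [X [FX [_ GB _ _] Xa Xb]]; exists X => //; apply: GB.
    - by move=> a b /two h /h [X [FX [_ _ GM _] Xa Xb]]; exists X => //; apply: GM.
    by move=> y hy; have [X [_ [_ _ _ Gf] Xa _]] := two _ _ hy hy; apply: Gf.
  left; apply/seteqP; split=> // a [X FX Xa]; case: (FP _ FX) => [X0|hX].
    by move: Xa; rewrite X0.
  by case: no; exists X.
have max_ext G' : partial_iso G' -> subset G G' -> subset G0 G' -> subset G' G.
  move=> isoG' sub sub0; apply: contrapT => nsub; apply: (maxG G'); last by right.
  by split.
have [isoG sub0] : partial_iso G /\ subset G0 G.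
  case: PG => // GG; exfalso; apply: (maxG G0); last by right; split.
  rewrite GG; split=> // sub; have [GE _ _ _] := iso0; exact: (sub _ (GE 0)).
have tot z : exists z', G (z, z').
  have [G' [z' [isoG' sub Gz]]] := partial_iso_extend_at z isoG; exists z'.
  by apply: (max_ext G') => // a /sub0/sub.
(* Surjectivity is totality of the transposed graph. *)
have sur z : exists z', G (z', z).
  have [G' [z' [isoG' sub Gz]]] := partial_iso_extend_at z (partial_iso_transpose isoG).
  exists z'; apply: (max_ext (transpose G')) => //.
  - exact: partial_iso_transpose.
  - by move=> [a b] Gab; apply: (sub (b, a)).
  by move=> [a b] /sub0 Gab; apply: (sub (b, a)).
case: (isoG) => GE GB GM Gf.
have fn a b b' : G (a, b) -> G (a, b') -> b = b'.
  move=> Gb Gb'; apply/eqP; rewrite -subr_eq0; apply/eqP; apply: Gf.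
  by have := GB _ _ Gb Gb'; rewrite -[_ - _]/(a - a, b - b') subrr.
have [s hs] := choice tot.
have s_sub : zmod_morphism s.
  by move=> a b; apply: (fn (a - b)) => //; have := GB _ _ (hs a) (hs b).
have s_mul : monoid_morphism s.
  split=> [|a b]; last by apply: (fn (a * b)) => //; have := GM _ _ (hs a) (hs b).
  by apply: (fn 1) => //; have := GE 1; rewrite /diag rmorph1.
exists (mk_rmorphism s_sub s_mul); split.
- have [t ht] := choice sur; exists t => [a|b].
    apply: (fmorph_inj (mk_rmorphism s_sub s_mul)) => /=.
    exact: (fn _ _ _ (hs _) (ht _)).
  exact: (fn _ _ _ (hs _) (ht _)).
- by move=> e; apply: (fn _ _ _ (hs _)); apply: GE.
by move=> [a b] /sub0 Gab; apply: (fn _ _ _ (hs _)).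
Qed.

(** Were the minimal polynomial of x not linear, it would have by separability a root x' other than
    x, and x -> x' would extend to an automorphism. *)
Lemma galois_fixed (x : L) :
    (forall s : {rmorphism L -> L}, bijective s -> (forall e, s (iota e) = iota e) -> s x = x) ->
  exists e, iota e = x.
Proof.
move=> fix_x; apply: contrapT => nex.
have iso0 := partial_iso_diag.
have [q [[sq q_sep ext] [q0 [Gq0 q0m q0x def_q]]]] := partial_iso_extend iso0 x.
have qx : root q x.
  apply/rootP; rewrite -q0x def_q; congr (_.[x]); apply/polyP => i; rewrite !coef_map /=.
  by case: (Gq0 i) => e _ <-.
have q_monic : q \is monic by rewrite def_q; apply: monic_map.
have /factor_theorem [r def_r] := qx.
have r0 : r != 0.
  by apply: contraTneq sq => r0; rewrite def_r r0 mul0r size_poly0.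
have sr : (1 < size r)%N.
  rewrite ltnNge; apply/negP => le1.
  have sr1 : size r = 1%N by apply/eqP; rewrite eqn_leq le1 size_poly_gt0.
  have rE : r = 1.
    move: q_monic; rewrite def_r monicE lead_coefM lead_coefXsubC mulr1 /lead_coef sr1 /=.
    by rewrite (size1_polyC le1) coefC /= => /eqP ->.
  apply: nex; case: (Gq0 0%N) => e _ he; exists (- e).
  have : q`_0 = iota e by rewrite def_q coef_map /= -he.
  by rewrite def_r rE mul1r coefB coefX coefC /= sub0r => hx; rewrite rmorphN -hx opprK.
have r_sep : separable_poly r by apply: dvdp_separable q_sep; rewrite def_r dvdp_mulr.
have [x' rx'] := sep_closed sr r_sep.
have qx' : root q x' by rewrite def_r rootM rx'.
have [G [isoG subG Gxx']] := ext _ qx'.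
have [s [s_bij s_fix s_G]] := partial_iso_total isoG.
have sx : s x = x' := s_G _ Gxx'.
have xx' : x' = x by rewrite -sx fix_x.
have := q_sep; rewrite def_r separable_mul => /and3P[_ _ /coprimep_root].
move/(_ x); rewrite -xx' => /(_ rx').
by rewrite hornerXsubC subrr eqxx.
Qed.

End GaloisFixed.

(** * The isogeny attached to a stable line *)

Lemma skew_monic_quot (R : comNzRingType) (q u : {poly R}) n d :
  skew_monic d u -> skew_monic (n + d) (skew_mul q u) -> skew_monic n q.
Proof.
move=> mu mqu; have su := skew_monic_size mu; have lu := skew_monic_lead mu.
have q0 : q != 0.
  apply: contraTneq mqu => ->; rewrite /skew_mul size_poly0 big_ord0.
  by apply/negP => /skew_monic_size; rewrite size_poly0.
have sq : size q = (size q).-1.+1 by rewrite prednK // size_poly_gt0.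
have top : (skew_mul q u)`_((size q).-1 + d) = lead_coef q.
  by rewrite skew_mul_coef_top -?sq ?su // lu expr1n mulr1.
have le : ((size q).-1 + d <= n + d)%N.
  rewrite -ltnS -(skew_monic_size mqu) ltnNge; apply/negP => /(nth_default 0)/eqP.
  by rewrite top lead_coef_eq0 (negPf q0).
have ge : (n + d <= (size q).-1 + d)%N.
  rewrite -ltnS -(skew_monic_size mqu); apply: size_skew_mul_leq; rewrite -?sq //.
  by rewrite su.
have En : (size q).-1 = n by apply/eqP; rewrite -(eqn_add2r d) eqn_leq le ge.
apply: skew_monicI; first by rewrite sq En.
by rewrite -(skew_monic_lead mqu) -En top.
Qed.

(** * Integrality over A *)

Section IntegralOver.
Variables (R : comNzRingType) (K : fieldType) (rho : {rmorphism R -> K}).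

Lemma integral_exp x n : integralOver rho x -> integralOver rho (x ^+ n).
Proof.
move=> hx; elim: n => [|n IH]; first by rewrite expr0; apply: integral1.
by rewrite exprS; apply: integral_mul.
Qed.

Lemma integral_sum I (r : seq I) (Q : pred I) (G : I -> K) :
  (forall i, Q i -> integralOver rho (G i)) -> integralOver rho (\sum_(i <- r | Q i) G i).
Proof.
move=> h; apply: (big_ind (integralOver rho)) => //; first exact: integral0.
by move=> x y; apply: integral_add.
Qed.

Lemma integral_skew_eval (f : {poly K}) y :
  (forall i, integralOver rho f`_i) -> integralOver rho y -> integralOver rho (skew_eval f y).
Proof.
by move=> hf hy; apply: integral_sum => i _; apply: integral_mul => //; apply: integral_exp.
Qed.

Lemma integral_skew_root (f : {poly R}) n x : skew_monic n f ->
  skew_eval (map_poly rho f) x = 0 -> integralOver rho x.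
Proof.
move=> mf fx0; pose Q : {poly R} := \sum_(i < n.+1) f`_i *: 'X^(2 ^ i).
exists Q.
  rewrite /Q big_ord_recr /= (skew_monic_lead mf) scale1r addrC.
  rewrite monicE lead_coefDl ?lead_coefXn // size_polyXn ltnS.
  apply: leq_trans (size_sum _ _ _) _; apply/bigmax_leqP => i _.
  apply: leq_trans (size_scale_leq _ _) _; rewrite size_polyXn.
  by rewrite ltn_exp2l.
apply/rootP; rewrite -fx0 (@skew_evalE _ n.+1); last first.
  by apply: leq_trans (size_poly _ _) _; rewrite (skew_monic_size mf).
rewrite rmorph_sum horner_sum; apply: eq_bigr => i _.
by rewrite /= map_polyZ hornerZ map_polyXn hornerXn coef_map.
Qed.
End IntegralOver.

Lemma frac_coprime (x : F) : exists a b : {poly 'F_2},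
  [/\ b != 0, coprimep a b & x = a%:F / b%:F].
Proof.
have [a [b [b0 ->]]] := fracP x; pose c := gcdp a b.
have c0 : c != 0 by rewrite gcdp_eq0 negb_and b0 orbT.
have Ea : a %/ c * c = a by apply/divpK/dvdp_gcdl.
have Eb : b %/ c * c = b by apply/divpK/dvdp_gcdr.
have b'0 : b %/ c != 0 by apply: contra_neq b0 => e; rewrite -Eb e mul0r.
exists (a %/ c), (b %/ c); split=> //; first by apply: coprimep_div_gcd; rewrite b0 orbT.
rewrite -[in LHS]Ea -[in LHS]Eb !tofracM invfM mulrACA divff ?mulr1 //.
by rewrite tofrac_eq0.
Qed.

Lemma rational_root (R : idomainType) (q : {poly R}) (a b : R) n :
    q \is monic -> size q = n.+1 -> b != 0 ->
    (map_poly (@FracField.tofrac R) q).[a%:F / b%:F] = 0 ->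
  a ^+ n + \sum_(i < n) q`_i * a ^+ i * b ^+ (n - i) = 0.
Proof.
move=> qm sq b0 qx; have bF : b%:F != 0 by rewrite tofrac_eq0.
apply/eqP; rewrite -tofrac_eq0 -(mul0r (b%:F ^+ n)) -qx; apply/eqP.
rewrite (@horner_coef_wide _ n.+1); last by rewrite -sq size_poly.
rewrite big_ord_recr /= mulrDl [RHS]addrC rmorphD; congr (_ + _).
  rewrite coef_map /=; have -> : q`_n = 1 by move/monicP: qm; rewrite /lead_coef sq.
  by rewrite rmorph1 mul1r rmorphXn expr_div_n mulfVK // expf_neq0.
rewrite rmorph_sum mulr_suml; apply: eq_bigr => i _.
rewrite coef_map /= !rmorphM !rmorphXn /= expr_div_n -!mulrA; congr (_ * (_ * _)).
have -> : b%:F ^+ n = b%:F ^+ i * b%:F ^+ (n - i).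
  by rewrite -exprD subnKC // ltnW.
by rewrite mulKf // expf_neq0.
Qed.

Lemma frac_integral (x : F) : integralOver (@FracField.tofrac {poly 'F_2}) x ->
  exists a : {poly 'F_2}, x = a%:F.
Proof.
have [a [b [b0 cop ->]]] := frac_coprime x => -[q qm /rootP qx].
suff b1 : b = 1 by exists a; rewrite b1 tofrac1 divr1.
apply: size1_F2; apply/eqP; rewrite -dvdp1.
have sq : size q = (size q).-1.+1 by rewrite prednK // size_poly_gt0 monic_neq0.
set n := (size q).-1 in sq.
have bF : b%:F != 0 by rewrite tofrac_eq0.
have E := rational_root qm sq b0 qx.
have dvd_an : b %| a ^+ n.
  have -> : a ^+ n = - \sum_(i < n) q`_i * a ^+ i * b ^+ (n - i).
    by apply/eqP; rewrite -addr_eq0 E.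
  rewrite dvdpNr; apply: (big_ind (fun z => b %| z)) => [|s t|i _]; [exact: dvdp0|exact: dvdp_add|].
  by apply: dvdp_mull; rewrite -(subnSK (ltn_ord i)) exprS dvdp_mulr.
have cop_n : coprimep b (a ^+ n) by apply: coprimep_expr; rewrite coprimep_sym.
by rewrite -(Gauss_dvdpr 1 cop_n) mulr1.
Qed.

(** * Descent of the kernel of the isogeny to A{tau} *)

Section StableLine.
Variables (L : fieldType) (iota : {rmorphism F -> L}) (hL : is_sep_closure iota).
Variables (p : {poly 'F_2}) (d : nat) (G : {poly 'F_2}).
Hypotheses (p_monic : p \is monic) (p_irr : irreducible_poly p) (p_size : size p = d.+1).
Hypothesis d_gt1 : (1 < d)%N.

Let rho : {rmorphism {poly 'F_2} -> L} := iota \o (@FracField.tofrac {poly 'F_2}).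
Let P : L -> L := drinfeld_map rho G.
Let act := poly_act rho P.

Variable x : L.
Hypothesis ann_x : forall a, act a x = 0 <-> p %| a.
Hypothesis gal_x : forall s : {rmorphism L -> L}, gal_aut iota s -> exists a, s x = act a x.

Let charL : 2%N \in [pchar L].
Proof. by apply: (rmorph_pchar iota); apply: pcharF. Qed.

Let rho_inj : injective rho.
Proof. by move=> a b /(fmorph_inj iota) /tofrac_inj. Qed.

Let P_add : forall y z, P (y + z) = P y + P z.
Proof. exact: drinfeld_map_add. Qed.

(** A Moore-type recursion killing x, P x, ..., P^(k-1) x: if c is the value at the next vector, tau
    + c kills c, as c^2 + c c = 0. *)
Fixpoint kernel_poly k : {poly L} :=
  if k is k'.+1 then
    skew_mul ('X + (skew_eval (kernel_poly k') (iter k' P x))%:P) (kernel_poly k')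
  else 1.

Lemma kernel_poly_monic k : skew_monic k (kernel_poly k).
Proof.
elim: k => [|k IH]; first by rewrite /skew_monic size_poly1 coef1 !eqxx.
apply: (@skew_monic_mul _ 1 k) => //.
by rewrite /skew_monic size_XaddC coefD coefX coefC addr0 !eqxx.
Qed.

Lemma kernel_poly_zero k j : (j < k)%N -> skew_eval (kernel_poly k) (iter j P x) = 0.
Proof.
elim: k => // k IH lt_jk; rewrite /= skew_eval_mul // skew_evalD skew_evalX skew_evalC.
move: lt_jk; rewrite ltnS leq_eqVlt => /predU1P[->|/IH ->].
  by rewrite expr2 addxx.
by rewrite expr0n mulr0 addr0.
Qed.

Let u := kernel_poly d.

Lemma kernel_poly_act a : skew_eval u (act a x) = 0.
Proof.
have -> : act a x = act (a %% p) x.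
  rewrite {1}(divp_eq a p) /act poly_actD poly_actM //.
  have -> : poly_act rho P p x = 0 by apply/ann_x.
  by rewrite poly_act_at0 // add0r.
have sa : (size (a %% p)%R <= d)%N by rewrite -ltnS -p_size ltn_modp -size_poly_gt0 p_size.
rewrite /act /poly_act skew_eval_bigsum // big1 // => i _.
have lt_id : (i < d)%N := leq_trans (ltn_ord i) sa.
case: (F2_cases (a %% p)`_i) => ->; rewrite ?polyC0 ?polyC1 ?rmorph0 ?rmorph1.
  by rewrite mul0r skew_eval0.
by rewrite mul1r kernel_poly_zero.
Qed.

(** The multiples of x by polynomials of degree below d are distinct, p dividing no nonzero
    difference; these are 2^d zeros, too many for [f]. *)
Lemma vanish_on_line (f : {poly L}) : (size f <= d)%N -> (forall a, skew_eval f (act a x) = 0) -> f = 0.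
Proof.
move=> sf f0; pose s := [seq act (rVpoly v) x | v <- enum 'rV['F_2]_d].
apply: (@skew_eval_zeros _ f s d) => //.
- rewrite map_inj_uniq ?enum_uniq // => v w E.
  have : act (rVpoly v - rVpoly w) x = 0.
    apply: (addIr (act (rVpoly w) x)).
    by rewrite /act -poly_actD subrK add0r.
  move/ann_x; have [e|ne] := eqVneq (rVpoly v - rVpoly w) 0.
    by move=> _; apply: (can_inj (@rVpolyK _ d)); apply/eqP; rewrite -subr_eq0 e.
  move/(dvdp_leq ne); rewrite p_size ltnNge => /negP[].
  apply: leq_trans (size_polyD _ _) _; rewrite size_polyN geq_max.
  by rewrite !size_poly.
- by rewrite size_map -cardE card_mx card_Fp // mul1n.
by move=> y /mapP [v _ ->].
Qed.

Lemma gal_act (s : {rmorphism L -> L}) : gal_aut iota s ->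
  forall a y, s (act a y) = act a (s y).
Proof.
case=> _ s_fix; apply: poly_act_intertwine => [y z|y]; first exact: rmorphD.
by rewrite /P /drinfeld_map !rmorphD rmorphXn 2!rmorphM rmorphXn /= !s_fix.
Qed.

(** s multiplies x by some e invertible modulo p, so it maps the line onto itself; the difference of
    s(u) and u has tau-degree below d and vanishes there. *)
Lemma kernel_poly_fixed (s : {rmorphism L -> L}) : gal_aut iota s -> map_poly s u = u.
Proof.
move=> gs; have [e se] := gal_x gs.
have p_ndvd_e : ~~ (p %| e).
  apply/negP => /ann_x e0; have /ann_x : act 1 x = 0.
    by rewrite /act poly_act1; apply: (fmorph_inj s); rewrite rmorph0 se e0.
  rewrite dvdp1 => /eqP sp1; move: d_gt1; rewrite -ltnS -p_size sp1 //.
have cop : coprimep e p by rewrite coprimep_sym; apply: irreducible_coprime.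
have [[e1 e2] /= Ee] := Bezout_eq1_coprimepP _ _ cop.
have mu := kernel_poly_monic d; have msu := skew_monic_map s mu.
apply/eqP; rewrite -subr_eq0; apply/eqP; apply: vanish_on_line.
  apply/leq_sizeP => j; rewrite leq_eqVlt => /predU1P[<-|lt_dj].
    by rewrite coefB (skew_monic_lead mu) (skew_monic_lead msu) subrr.
  by rewrite coefB !nth_default ?subrr // ?(skew_monic_size mu) ?(skew_monic_size msu).
move=> a; rewrite skew_evalD -scaleN1r skew_evalZ kernel_poly_act mulr0 addr0.
have -> : act a x = s (act (a * e1) x).
  rewrite gal_act // se /act -poly_actM // -[in LHS](mulr1 a) -Ee mulrDr mulrA.
  rewrite poly_actD mulrA [poly_act _ _ (_ * p) x]poly_actM //.
  have -> : poly_act rho P p x = 0 by apply/ann_x.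
  by rewrite poly_act_at0 // addr0.
by rewrite skew_eval_map kernel_poly_act rmorph0.
Qed.

Lemma x_integral : integralOver rho x.
Proof.
apply: (integral_skew_root (drinfeld_poly_monic G p_monic p_size)).
by rewrite drinfeld_polyE //; apply/ann_x.
Qed.

Lemma kernel_poly_integral k i : integralOver rho (kernel_poly k)`_i.
Proof.
have int_it j : integralOver rho (iter j P x).
  elim: j => [|j IH] /=; first exact: x_integral.
  apply: integral_add; last exact: integral_exp.
  by apply: integral_add; apply: integral_mul; (try exact: integral_exp) => //; apply: integral_id.
elim: k i => [|k IH] i /=; first by rewrite coef1; apply: integral_nat.
rewrite coef_skew_mul; apply: integral_sum => j _; apply: integral_mul.
  rewrite coefD coefX coefC; apply: integral_add; first exact: integral_nat.
  case: ifP => _; last exact: integral0.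
  exact: integral_skew_eval.
exact: integral_exp.
Qed.

Lemma kernel_poly_coef i : exists a, rho a = u`_i.
Proof.
have [sep_alg sep_closed] := hL.
have [|e he] := @galois_fixed _ _ iota sep_alg sep_closed u`_i.
  by move=> s sb sf; have := kernel_poly_fixed (conj sb sf) => {2}<-; rewrite coef_map.
have : integralOver rho u`_i := kernel_poly_integral d i.
rewrite -he => -[q qm /rootP qe].
have [|a Ea] := @frac_integral e; last by exists a; rewrite Ea.
exists q => //; apply/rootP; apply: (fmorph_inj iota); rewrite rmorph0 -qe.
by rewrite -horner_map -map_poly_comp.
Qed.

Theorem no_stable_line : False.
Proof.
have [c hc] := choice kernel_poly_coef.
pose w : {poly {poly 'F_2}} := \poly_(i < d.+1) c i.
have mu := kernel_poly_monic d.
have Ew : map_poly rho w = u.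
  apply/polyP => i; rewrite coef_map coef_poly /=; case: ltnP => [_|le_di]; first exact: hc.
  by rewrite rmorph0 nth_default // (skew_monic_size mu).
have mw : skew_monic d w.
  apply: skew_monicI; first exact: size_poly.
  by apply: rho_inj; rewrite rmorph1 -(coef_map rho) Ew (skew_monic_lead mu).
have vanish (r : {poly {poly 'F_2}}) : (size r <= d)%N ->
    (forall a, skew_eval (map_poly rho r) (act a x) = 0) -> r = 0.
  move=> sr r0; have := vanish_on_line (leq_trans (size_poly _ _) sr) r0.
  by move/polyP => E; apply/polyP => i; apply: rho_inj; rewrite -(coef_map rho) E !coef0 rmorph0.
(* The remainder of right division by w vanishes on the line with tau-degree below d. *)
have quot f : (forall a, skew_eval (map_poly rho f) (act a x) = 0) ->
    exists q, skew_mul q w = f.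
  move=> f0; have [q [r [Ef sr]]] := skew_div f mw.
  exists q; rewrite Ef (vanish r sr) ?addr0 // => a.
  have := f0 a; rewrite Ef rmorphD skew_evalD /= map_skew_mul skew_eval_mul // Ew.
  by rewrite kernel_poly_act skew_eval0 // add0r.
have [|v Ev] := quot (drinfeld_poly G p).
  move=> a; rewrite drinfeld_polyE // -/act /act -poly_actM // mulrC poly_actM //.
  have -> : poly_act rho P p x = 0 by apply/ann_x.
  by rewrite poly_act_at0.
have [|q Eq] := quot (skew_mul w (drinfeld_T G)).
  move=> a; rewrite map_skew_mul skew_eval_mul // Ew drinfeld_mapE -/P.
  by rewrite -(poly_actMX rho P_add) kernel_poly_act.
have mv : skew_monic d v.
  apply: (skew_monic_quot mw); rewrite Ev addnn -mul2n.
  exact: drinfeld_poly_monic.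
have mq : skew_monic 2 q.
  apply: (skew_monic_quot mw); rewrite Eq (addnC 2).
  exact: (skew_monic_mul mw (drinfeld_T_monic G)).
have p0 : p != 0 by apply: monic_neq0.
have w0 : w`_0 != 0.
  apply: contra_neq p0 => w0; rewrite -(drinfeld_poly_coef0 G p) -Ev coef0_skew_mul.
  by rewrite w0 mulr0.
(* Constant terms give q_0 w_0 = w_0 T. *)
have q0 : q`_0 = 'X.
  apply: (mulIf w0); rewrite -coef0_skew_mul Eq coef0_skew_mul drinfeld_T_coef.
  by rewrite mulrC.
have def_q : q = drinfeld_T q`_1.
  apply/polyP => -[|[|[|i]]]; rewrite drinfeld_T_coef //.
    exact: skew_monic_lead mq.
  by rewrite nth_default // (skew_monic_size mq).
apply: (no_isogeny p_irr p_size d_gt1 mw mv) Ev.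
by rewrite -Eq {1}def_q.
Qed.
End StableLine.

(** * Good reduction and a global minimal model *)

Lemma monic_F2 (q : {poly 'F_2}) : q != 0 -> q \is monic.
Proof. by move=> q0; rewrite monicE (F2_neq0 (c := lead_coef q)) ?lead_coef_eq0. Qed.

Lemma irreducible_divisor (q : {poly 'F_2}) : q != 0 -> size q != 1%N ->
  exists P : {poly 'F_2}, [/\ P \is monic, irreducible_poly P & P %| q].
Proof.
move=> q0 sq; pose Q n := `[< exists P : {poly 'F_2}, [/\ P %| q, size P != 1%N & size P = n] >].
have exQ : exists n, Q n by exists (size q); apply/asboolP; exists q.
case: (ex_minnP exQ) => n /asboolP [P [dvdP sP EP]] min_n.
have P0 : P != 0 by apply: contraTneq dvdP => ->; rewrite dvd0p.
exists P; split=> //; first exact: monic_F2.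
split; first by rewrite ltn_neqAle eq_sym sP size_poly_gt0.
move=> r sr dvdr; rewrite -dvdp_size_eqp // eqn_leq dvdp_leq //= EP; apply: min_n.
by apply/asboolP; exists r; split=> //; apply: dvdp_trans dvdr dvdP.
Qed.

Lemma tofrac_div_eq (a b c e : {poly 'F_2}) : b != 0 -> e != 0 ->
  a%:F / b%:F = c%:F / e%:F :> F -> a * e = c * b.
Proof.
move=> b0 e0 /eqP; rewrite eqr_div ?tofrac_eq0 // -!tofracM tofrac_eq => /eqP ->.
by rewrite mulrC.
Qed.

Lemma div_cube (K : fieldType) (a b : K) : b != 0 -> a / b = a * b ^+ 2 * b^-1 ^+ 3.
Proof. by move=> b0; field. Qed.

Lemma cube_div (K : fieldType) (a b t : K) : a != 0 -> b != 0 -> t != 0 ->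
  t ^+ 3 / (a / b * t ^+ 3) = b / a.
Proof. by move=> a0 b0 t0; field; rewrite a0 b0 t0. Qed.

Lemma neq0_of_ndvd (P b : {poly 'F_2}) : ~~ (P %| b) -> b != 0.
Proof. by apply: contraNneq => ->; apply: dvdp0. Qed.

Section GoodReduction.
Variables (g D : F) (D_neq0 : D != 0).
Hypothesis good : forall P : A, P \is monic -> irreducible_poly P -> good_reduction_at P g D.

Lemma good_reduction_data (P : {poly 'F_2}) : P \is monic -> irreducible_poly P ->
  exists (t : F) (a b c e : {poly 'F_2}), [/\ t != 0,
    [/\ ~~ (P %| a), ~~ (P %| b) & ~~ (P %| e)],
    D = a%:F / b%:F * t ^+ 3 & g = c%:F / e%:F * t].
Proof.
move=> Pm Pi; have [g' [D' [[t [t0 [_ [Eg ED]]]] [[c [e [ne Eg']]] [_ [a [b [na [nb ED']]]]]]]]] := good Pm Pi.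
exists t, a, b, c, e; split=> //.
  by apply: (mulfI t0); rewrite ED ED' (exprS t 3) mulrCA.
by apply: (mulfI t0); rewrite Eg Eg' expr2 mulrCA.
Qed.

(** At each P the valuation of D is 3 times that of the local scaling factor. The descent strips P^3
    from N in D = N w^3 until N is the unit 1. *)
Lemma discriminant_cube : exists2 w : F, w != 0 & D = w ^+ 3.
Proof.
suff descent n : forall (N : {poly 'F_2}) (w : F), (size N <= n)%N -> N != 0 -> w != 0 ->
    D = N%:F * w ^+ 3 -> exists2 w : F, w != 0 & D = w ^+ 3.
  have [a [b [a0 b0 ED]]] := frac_neq0P D_neq0.
  have bF : b%:F != 0 by rewrite tofrac_eq0.
  (* The start is a / b = (a b^2) (1 / b)^3, with N in A. *)
  apply: (descent _ (a * b ^+ 2) (b%:F)^-1 (leqnn _)).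
  - by rewrite mulf_neq0 ?expf_neq0.
  - by rewrite invr_neq0.
  by rewrite ED tofracM rmorphXn; apply: div_cube.
elim: n => [|n IH] N w sN N0 w0 ED.
  by move: sN; rewrite leqn0 size_poly_eq0 (negPf N0).
have [s1|s1] := eqVneq (size N) 1%N.
  by exists w => //; rewrite ED (size1_F2 s1) tofrac1 mul1r.
have [P [Pm Pi PN]] := irreducible_divisor N0 s1.
have [t [a [b [c [e [t0 [na nb ne] ED' _]]]]]] := good_reduction_data Pm Pi.
have [x [y [y0 cop Exy]]] := frac_coprime (w / t).
have b0 := neq0_of_ndvd nb.
have E : N * x ^+ 3 * b = a * y ^+ 3.
  apply: tofrac_div_eq => //; first by rewrite expf_neq0.
  rewrite tofracM !rmorphXn -mulrA -expr_div_n -Exy expr_div_n mulrA -ED ED'.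
  exact: (mulfK (expf_neq0 3 t0)).
(* P divides N but not a, so it divides y; then x is prime to P, and P^3 must come from N. *)
have Py : P %| y.
  have : P %| a * y ^+ 3 by rewrite -E -mulrA dvdp_mulr.
  by move/(irreducible_dvd_mul Pi); rewrite (negPf na) /= => /(irreducible_dvd_exp Pi).
have nx : ~~ (P %| x) by apply/negP => Px; apply: (irreducible_coprime_dvd Pi cop).
have P3N : P ^+ 3 %| N.
  have : P ^+ 3 %| N * (x ^+ 3 * b).
    by rewrite mulrA E dvdp_mull // dvdp_exp2r.
  rewrite Gauss_dvdpl // coprimepMr; apply/andP; split.
    by apply: coprimep_expl; apply: coprimep_expr; apply: irreducible_coprime.
  by apply: coprimep_expl; apply: irreducible_coprime.
have [N1 EN1] := dvdpP _ _ P3N.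
have P0 : P != 0 by apply: monic_neq0.
have N10 : N1 != 0 by apply: contra_neq N0 => e0; rewrite EN1 e0 mul0r.
apply: (IH N1 (P%:F * w)).
- rewrite -ltnS; apply: leq_trans sN; rewrite EN1 size_mul ?expf_neq0 //.
  have : (1 < size (P ^+ 3)%R)%N.
    apply: leq_trans (dvdp_leq _ (_ : P %| P ^+ 3)); first by case: Pi.
      by rewrite expf_neq0.
    by rewrite exprS dvdp_mulr.
  move: (size (P ^+ 3)) (size N1) => k m; clear; lia.
- exact: N10.
- by apply: mulf_neq0 w0; rewrite tofrac_eq0.
rewrite [LHS]ED EN1 tofracM rmorphXn exprMn; exact: esym (mulrA _ _ _).
Qed.

(** As D = w^3, w has at P the valuation of the local factor t, so g / w is integral at P because g
    / t is. A fraction integral at every P is a polynomial. *)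
Lemma good_model : exists (w : F) (G : {poly 'F_2}),
  [/\ w != 0, D = w ^+ 3 & g = w * G%:F].
Proof.
have [w w0 EDw] := discriminant_cube; exists w.
have [x [y [y0 cop Exy]]] := frac_coprime (g / w).
suff sy : size y = 1%N.
  exists x; split=> //; rewrite (size1_F2 sy) tofrac1 divr1 in Exy.
  by rewrite -Exy mulrC mulfVK.
apply/eqP; apply: contraT => sy.
have [P [Pm Pi Py]] := irreducible_divisor y0 sy.
have [t [a [b [c [e [t0 [na nb ne] ED Eg]]]]]] := good_reduction_data Pm Pi.
have [x1 [y1 [y10 cop1 E1]]] := frac_coprime (t / w).
have a0 := neq0_of_ndvd na; have b0 := neq0_of_ndvd nb; have e0 := neq0_of_ndvd ne.
have aF : a%:F != 0 :> F by rewrite tofrac_eq0.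
have bF : b%:F != 0 :> F by rewrite tofrac_eq0.
have Ea : x1 ^+ 3 * a = b * y1 ^+ 3.
  apply: tofrac_div_eq => //; first by rewrite expf_neq0.
  rewrite !rmorphXn -expr_div_n -E1 expr_div_n -EDw ED.
  exact: (cube_div aF bF t0).
have ny1 : ~~ (P %| y1).
  apply/negP => Py1; have : P %| x1 ^+ 3 * a by rewrite Ea dvdp_mull // exprS dvdp_mulr.
  move/(irreducible_dvd_mul Pi); rewrite (negPf na) orbF => /(irreducible_dvd_exp Pi) Px1.
  exact: (irreducible_coprime_dvd Pi cop1).
have Ex : x * (e * y1) = c * x1 * y.
  apply: tofrac_div_eq => //; first by rewrite mulf_neq0.
  by rewrite -Exy Eg !tofracM -mulf_div -E1 mulrA.
have : P %| x * (e * y1) by rewrite Ex dvdp_mull.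
move/(irreducible_dvd_mul Pi)/orP => [Px|/(irreducible_dvd_mul Pi)].
  by case: (irreducible_coprime_dvd Pi cop Px Py).
by rewrite (negPf ne) (negPf ny1).
Qed.
End GoodReduction.

Theorem theorem8p10 (pi : A) (pi_monic : pi \is monic) (pi_irr : irreducible_poly pi)
    (pi_deg : (3 < size pi)%N)
    (g D : F) (D_neq0 : D != 0)
    (good : forall P : A, P \is monic -> irreducible_poly P -> good_reduction_at P g D)
    (L : fieldType) (iota : {rmorphism F -> L}) (hL : is_sep_closure iota) :
  ~ (exists C : L -> Prop, cyclic_ptors iota g D pi C /\ gal_invariant iota C).
Proof.
case=> C [[_ [x [Cx ann_x]]] invC].
have [w [G [w0 ED Eg]]] := good_model D_neq0 good.
pose rho : {rmorphism {poly 'F_2} -> L} := iota \o (@FracField.tofrac {poly 'F_2}).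
have [d sp d1] : exists2 d, size pi = d.+1 & (1 < d)%N.
  by case: (size pi) pi_deg => // d lt; exists d => //; apply: ltnW.
have iw0 : iota w != 0 by rewrite fmorph_eq0.
(* Multiplication by w carries phi to T + G tau + tau^2, since w g = G w^2 and w D = w^4. *)
have wact a y : iota w * phi_act iota g D a y =
    poly_act rho (drinfeld_map rho G) a (iota w * y).
  apply: (@poly_act_intertwine _ _ rho rho (phiT iota g D) (drinfeld_map rho G)
    (fun z => iota w * z)) => [y1 y2|z]; first exact: mulrDr.
  rewrite /phiT /drinfeld_map Eg ED /= rmorphM rmorphXn /Tvar; ring.
apply: (@no_stable_line L iota hL pi d G pi_monic pi_irr sp d1 (iota w * x)).
  move=> a; rewrite -wact -ann_x; split=> [/eqP|->]; last by rewrite mulr0.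
  by rewrite mulf_eq0 (negPf iw0) => /eqP.
move=> s gs; have Cx0 : C x.
  apply/Cx; exists 1; exact: esym (poly_act1 rho (phiT iota g D) x).
have /Cx [a Ea] : C (s x) by apply/(invC s gs (s x)); exists x.
by exists a; rewrite -wact -Ea rmorphM; case: gs => _ ->.
Qed.
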